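(* Let $\beta\in(1,2)$ be such that $\epsilon(1,\beta)=1^m0^\infty$ for some integer $m\ge3$. (1) If $0\le a<\frac{1}{m}$, then $F_{\beta,a}=\emptyset$ and $\dim_H F_{\beta,a}=0$. (2) If $\frac{1}{m}\le a\le1$, then $$\dim_H F_{\beta,a}=\frac{1}{\log\beta}\cdot\max_{x_1,\dots,x_{m-2}} f_a(x_1,\dots,x_{m-2}),$$ where, writing $x_0:=a$, $$\begin{aligned} f_a(x_1,\dots,x_{m-2})=\ & a\log a-\sum_{j=1}^{m-2}(x_{j-1}-x_j)\log(x_{j-1}-x_j)\\ &-(1-a-x_1-\cdots-x_{m-2})\log(1-a-x_1-\cdots-x_{m-2})\\ &-(x_1+\cdots+x_{m-3}+2x_{m-2}+a-1)\log(x_1+\cdots+x_{m-3}+2x_{m-2}+a-1) \end{aligned}$$ and the maximum is taken over all real $x_1,\dots,x_{m-2}$ such that all terms in the logarithms are non-negative, that is, $a\ge x_1\ge x_2\ge\cdots\ge x_{m-2}\ge0$ and $x_1+\cdots+x_{m-3}+x_{m-2}\le 1-a\le x_1+\cdots+x_{m-3}+2x_{m-2}$. In particular, $\dim_H F_{\beta,\frac{1}{m}}=\dim_H F_{\beta,1}=0$.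
   Context: For $\beta>1$, the $\beta$-transformation $T_\beta:[0,1]\to[0,1]$ is $T_\beta(x):=\beta x-\lfloor\beta x\rfloor$. For $x\in[0,1]$ and $n\in\mathbb{N}=\{1,2,\dots\}$ put $\epsilon_n(x,\beta):=\lfloor\beta T_\beta^{n-1}(x)\rfloor$; the sequence $\epsilon(x,\beta)=\epsilon_1(x,\beta)\epsilon_2(x,\beta)\cdots$ is the (greedy) $\beta$-expansion of $x$. $1^m0^\infty$ is the sequence of $m$ ones followed by infinitely many zeros. For $a\in[0,1]$, $F_{\beta,a}:=\{x\in[0,1):\lim_{n\to\infty}\frac1n\#\{1\le k\le n:\epsilon_k(x,\beta)=0\}=a\}$. $\dim_H$ is Hausdorff dimension in $\mathbb{R}$. Convention: $0\log0=0$. When $m=3$ the sum $x_1+\cdots+x_{m-3}$ is empty (equal to $0$). *)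

(* Defs.v *)
From HB Require Import structures.
From mathcomp Require Import all_boot all_order all_algebra.
From mathcomp Require Import all_classical all_reals all_analysis.

Set Implicit Arguments.
Unset Strict Implicit.
Unset Printing Implicit Defensive.

Import Order.TTheory GRing.Theory Num.Theory.
Import numFieldNormedType.Exports.

Local Open Scope classical_set_scope.
Local Open Scope ring_scope.

Section Expansions.
Context {R : realType}.
Implicit Types (beta x a : R) (n : nat).

Definition beta_transf beta x : R := beta * x - (Num.floor (beta * x))%:~R.

(* Digits are indexed from 1; the value at n = 0 is junk (it repeats that at
   n = 1). *)
Definition digit beta n x : int :=
  Num.floor (beta * iter n.-1 (beta_transf beta) x).

Definition num_zero_digits beta n x : nat :=
  count (fun k => digit beta k x == 0) (iota 1 n).

Definition freq_set beta a : set R :=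
  [set x | 0 <= x < 1 /\
    (fun n => (num_zero_digits beta n x)%:R / n%:R : R) @ \oo --> a].

End Expansions.

Section HausdorffDimension.
Context {R : realType}.
Implicit Types (s delta : R) (E U : set R).
Local Open Scope ereal_scope.

Definition diam U : \bar R :=
  ereal_sup [set `|p.1 - p.2|%:E | p in U `*` U].

(* The empty set contributes 0 even for s = 0, whereas a nonempty set of
   diameter 0 contributes 0 `^ 0 = 1 for s = 0. *)
Definition diam_pow s U : \bar R :=
  if U == set0 then 0 else diam U `^ s.

Definition hausdorff_pre s delta E : \bar R :=
  ereal_inf [set \sum_(0 <= i <oo) diam_pow s (U i) | U in
    [set U : nat -> set R | E `<=` \bigcup_i U i /\
                            forall i, diam (U i) <= delta%:E]].

(* hausdorff_pre s delta E is nonincreasing in delta, so its limit as delta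
   tends to 0 from the right is the supremum over delta > 0. *)
Definition hausdorff_measure s E : \bar R :=
  ereal_sup [set hausdorff_pre s delta E | delta in [set delta | (0 < delta)%R]].

Definition hausdorff_dim E : \bar R :=
  ereal_inf [set s%:E | s in [set s | (0 <= s)%R /\ hausdorff_measure s E = 0]].

End HausdorffDimension.

Section Optimization.
Context {R : realType}.
Variables (m : nat) (a : R).
Implicit Type x : (m - 2).-tuple R.

(* extended_coord x 0 = a and, for 1 <= j <= m - 2, extended_coord x j is the j-th variable x_j. *)
Definition extended_coord x (j : nat) : R := nth 0 (a :: x) j.

(* 0 * ln 0 = 0 holds because ring multiplication by 0 absorbs the value of
   ln at 0. *)
Definition objective x : R :=
  let X := extended_coord x in
  let last1 := 1 - a - \sum_(1 <= j < m.-1) X j in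
  let last2 := \sum_(1 <= j < m - 2) X j + 2 * X (m - 2)%N + a - 1 in
  a * ln a
  - \sum_(1 <= j < m.-1) (X j.-1 - X j) * ln (X j.-1 - X j)
  - last1 * ln last1
  - last2 * ln last2.

Definition feasible : set ((m - 2).-tuple R) :=
  [set x | [/\ forall j : nat, (1 <= j <= m - 2)%N ->
                 extended_coord x j <= extended_coord x j.-1,
               0 <= extended_coord x (m - 2),
               \sum_(1 <= j < m.-1) extended_coord x j <= 1 - a &
               1 - a <= \sum_(1 <= j < m - 2) extended_coord x j
                        + 2 * extended_coord x (m - 2)]].

End Optimization.

Arguments feasible {R} m a _.

Definition is_maximum {R : realType} (A : set R) (M : R) : Prop :=
  A M /\ ubound A M.

(* Main.v *)
Require Import Defs.
From HB Require Import structures.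
From mathcomp Require Import all_boot all_order all_algebra.
From mathcomp Require Import all_classical all_reals all_analysis.
From mathcomp Require Import ring lra zify.
Import Order.TTheory GRing.Theory Num.Theory.
Import numFieldNormedType.Exports.
Local Open Scope classical_set_scope.
Local Open Scope ring_scope.

(** Put b = 1 / beta.  The expansion of 1 says b + b^2 + ... + b^m = 1, and
    the greedy expansions of the points of [0, 1[ are sequences of zeros and
    ones in which the word 1^m does not occur.  Conversely, such a sequence is
    the greedy expansion of its value as soon as it contains 00 infinitely
    often ([greedy_word_bounded_runs], [expansion_value_greedy]).  Among m
    consecutive digits one is 0, so the frequency of 0 is at least 1 / m
    ([freq_set_empty]).

    Cut a sequence without 1^m into blocks 0 1^j with 0 <= j < m.  If p_j is
    the frequency of the block 0 1^j, then the p_j are nonnegative, their sum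
    is a, and the sum of the (j + 1) p_j is 1 ([block_law]).  The variables x_j
    of the optimization problem are the frequencies p_j + p_(j+1) + ... of the
    words 0 1^j, and the objective is the entropy
    a log a - sum_j p_j log p_j = sum_j p_j log (a / p_j)
    ([objective_entropy], [law_point_feasible]).

    Upper bound.  For t > 0 and Z = 1 + t + ... + t^(m-1), the sum of
    t^(number of ones) Z^(- number of zeros) over the words of length n
    without 1^m is at most Z ([sum_word_weight_le]).  Hence there are at most
    exp (n (P + o(1))) such words with about a n zeros, where
    P = a log Z - (1 - a) log t, and covering by the corresponding cylinders,
    whose diameters are at most b^n, bounds the dimension by P / log beta
    ([hausdorff_dim_freq_set_le]).

    Lower bound.  Given p, build expansions in stages: at stage k arrange
    in any order about k p_j copies of each block 0 1^j, then write 00.  The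
    frequency of 0 in the resulting sequence is a ([coded_seq_frequency]), and
    the number of arrangements at stage k is a multinomial coefficient, whose
    logarithm is k times the entropy of p up to O(log k)
    ([ln_stage_choices_ge]).  Writing t in [0, 1[ in the mixed radix system
    given by the numbers of arrangements selects one arrangement at each stage.
    This codes a subset of the frequency set by t, and the inverse of the
    coding is Hölder continuous with any exponent s smaller than the entropy
    divided by log beta.  A cover of the subset thus pulls back to a cover of
    [0, 1[, whose Lebesgue measure is 1, and the s-dimensional Hausdorff measure
    is positive ([hausdorff_measure_freq_set_neq0]).

    Optimization.  By the Gibbs inequality the entropy of every law p is at
    most P for every t > 0 ([block_entropy_le_pressure]).  For
    1 / m < a < 1 equality holds for p_j = a t^j / Z, with t chosen by the
    intermediate value theorem so that p is a law; for a = 1 / m and a = 1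
    the infimum of P is 0 ([optimal_block_law]).  So the maximal entropy and
    the infimum of P coincide, and the two bounds meet. *)

(** * Words without long runs of ones *)

(** For r < m: the words, with 0 = false and 1 = true, that do not contain 1^m and
    start with at most r ones; r counts the ones that may be read before a zero. *)
Fixpoint bounded_runs (m r : nat) (w : seq bool) : bool :=
  match w with
  | [::] => true
  | false :: w' => bounded_runs m m.-1 w'
  | true :: w' => if r is r'.+1 then bounded_runs m r' w' else false
  end.

Lemma bounded_runs_weaken (m r r' : nat) (w : seq bool) :
  (r <= r')%N -> bounded_runs m r w -> bounded_runs m r' w.
Proof.
elim: w r r' => [//|[] w IH] r r' //=.
by case: r r' => [//|r] [//|r'] /= le_r; apply: IH.
Qed.

Lemma bounded_runs_catl (m r : nat) (u v : seq bool) :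
  bounded_runs m r (u ++ v) -> bounded_runs m r u.
Proof.
elim: u r => [//|[] u IH] r /=; last exact: IH.
by case: r => [//|r]; apply: IH.
Qed.

Lemma bounded_runs_catr (m r : nat) (u v : seq bool) :
  (r <= m.-1)%N -> bounded_runs m r (u ++ v) -> bounded_runs m m.-1 v.
Proof.
elim: u r => [|[] u IH] r le_r /=; first exact: bounded_runs_weaken.
- by case: r le_r => [//|r] le_r; apply: IH; apply: ltnW.
- exact: IH.
Qed.

Lemma bounded_runs_cat_zero (m r : nat) (u v : seq bool) :
  bounded_runs m r (u ++ false :: v)
  = bounded_runs m r u && bounded_runs m m.-1 v.
Proof.
elim: u r => [//|[] u IH] r /=; last exact: IH.
by case: r => [//|r]; apply: IH.
Qed.

Lemma bounded_runs_zeros (m r : nat) (w : seq bool) :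
  (0 < m)%N -> bounded_runs m r w ->
  (size w <= m * count negb w + r)%N.
Proof.
move=> m_gt0; elim: w r => [|[] w IH] r //=.
- by case: r => [//|r] /IH; lia.
- by move/IH; rewrite mulnDr; lia.
Qed.

(** The block 0 1^j. *)
Definition block (j : nat) : seq bool := false :: nseq j true.

Lemma bounded_runs_blocks (m r : nat) (s : seq nat) :
  all (fun j => j < m)%N s -> bounded_runs m r (flatten (map block s)).
Proof.
case: s => [//|j s] /=.
elim: s j {r} => [|k s IH] j /= /andP[jm hs].
- have : (j <= m.-1)%N by lia.
  elim: j m.-1 {jm} => [//|j IHj] [|r] //= jr; exact: IHj.
- have {IH} H := IH k hs.
  have : (j <= m.-1)%N by lia.
  elim: j m.-1 {jm} => [|j IHj] r //= jr.
  by case: r jr => [//|r] jr; apply: IHj.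
Qed.

Lemma size_block (j : nat) : size (block j) = j.+1.
Proof. by rewrite /= size_nseq. Qed.

Lemma zeros_block (j : nat) : count negb (block j) = 1%N.
Proof. by rewrite /= count_nseq. Qed.

Lemma flatten_block_inj : injective (fun s => flatten (map block s)).
Proof.
elim=> [|i s IH] [|j t] //= [].
move=> H; suff [-> /IH ->] : i = j /\
  flatten (map block s) = flatten (map block t) by [].
elim: i j H {IH} => [|i IHi] [|j] //=.
- by case: (s).
- by case: (t).
- by case=> /IHi [-> ->].
Qed.

Section Value.
Context {R : realType}.
Implicit Types (b : R) (w : seq bool) (m r : nat).

(** The sum of w_i b^i, the letters of w being numbered from i = 1. *)
Fixpoint word_value b w : R :=
  if w is c :: w' then b * (c%:R + word_value b w') else 0.

Lemma word_value_cat b u v :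
  word_value b (u ++ v) = word_value b u + b ^+ size u * word_value b v.
Proof.
elim: u => [|c u IH] /=; first by rewrite expr0; ring.
by rewrite IH exprS; ring.
Qed.

Lemma word_value_ge0 b w : 0 <= b -> 0 <= word_value b w.
Proof.
by move=> b0; elim: w => [//|c w IH] /=; rewrite mulr_ge0 // addr_ge0.
Qed.

(** If b + ... + b^m = 1, the value of a word without 1^m that starts with at
    most r ones is at most that of 1^(r+1); for r = m - 1 the bound is 1. *)
Lemma word_value_bounded_runs b m r w : 0 <= b ->
  word_value b (nseq m true) = 1 -> bounded_runs m r w ->
  word_value b w <= word_value b (nseq r.+1 true).
Proof.
move=> b0 hb; have m0 : (0 < m)%N.
  by case: m hb => //= /esym/eqP; rewrite oner_eq0.
elim: w r => [|[] w IH] r; first by rewrite word_value_ge0.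
- case: r => [//|r] /IH h; rewrite [leLHS]/= [leRHS]/=.
  by rewrite ler_wpM2l // lerD2l.
- move=> /= /IH; rewrite prednK // hb => h.
  rewrite ler_wpM2l //= add0r (le_trans h) // lerDl.
  exact: word_value_ge0.
Qed.

(** Two consecutive zeros leave room below the bound: replacing 00 and what
    follows by 011 increases the value and still avoids 1^m, because m >= 3. *)
Lemma word_value_gap b m r u v : 0 <= b -> (3 <= m)%N ->
  word_value b (nseq m true) = 1 -> bounded_runs m r u ->
  bounded_runs m m.-1 v ->
  word_value b (u ++ false :: false :: v) + b ^+ (size u + 3)
    <= word_value b (nseq r.+1 true).
Proof.
move=> b0 m3 hb hu hv.
have m0 : (0 < m)%N by apply: leq_trans m3.
have : bounded_runs m r (u ++ [:: false; true; true]).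
  rewrite bounded_runs_cat_zero hu /=.
  by case: (m) m3 => [|[|[|?]]].
move/(word_value_bounded_runs _ _ _ _ b0 hb); apply: le_trans.
rewrite !word_value_cat -addrA lerD2l exprD -mulrDr ler_wpM2l ?exprn_ge0 //=.
have := word_value_bounded_runs _ _ _ _ b0 hb hv; rewrite prednK // hb => hv1.
rewrite !add0r addr0 mulrDr mulr1 exprS expr2 mulrDr lerD2r.
by rewrite mulrA -[leRHS]mulr1 ler_wpM2l // mulr_ge0.
Qed.
End Value.

(** * Greedy expansions *)

Section Greedy.
Context {R : realType}.
Implicit Types (beta b x : R) (n m r : nat).

Lemma expr_small b e : 0 <= b < 1 -> 0 < e ->
  exists N : nat, forall n, (N <= n)%N -> b ^+ n < e.
Proof.
move=> /andP[b0 b1] e0.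
have : b ^+ n @[n --> \oo] --> 0 by apply: cvg_expr; rewrite ger0_norm.
move/cvgrPdist_lt => /(_ _ e0) [N _ HN]; exists N => n Nn.
by have := HN n Nn; rewrite /= sub0r normrN ger0_norm // exprn_ge0.
Qed.

(** The first n digits of the expansion of x. *)
Definition greedy_word beta n x : seq bool :=
  mkseq (fun k => digit beta k.+1 x == 1) n.

Lemma size_greedy_word beta n x : size (greedy_word beta n x) = n.
Proof. by rewrite size_mkseq. Qed.

Lemma digitS beta n x : digit beta n.+2 x = digit beta n.+1 (beta_transf beta x).
Proof. by rewrite /digit /= -iterSr. Qed.

Lemma greedy_wordS beta n x : greedy_word beta n.+1 x =
  (digit beta 1 x == 1) :: greedy_word beta n (beta_transf beta x).
Proof.
rewrite /greedy_word /mkseq /= (iotaDl 1 0) -map_comp; congr cons.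
by apply: eq_map => k /=; rewrite add1n digitS.
Qed.

Lemma beta_transf_itv beta x : 0 <= beta_transf beta x < 1.
Proof.
rewrite /beta_transf; have /andP[] := floor_itv (beta * x).
rewrite intrD; lra.
Qed.

Lemma digit1_01 beta x : 1 < beta < 2 -> 0 <= x < 1 ->
  digit beta 1 x = (1 <= beta * x)%R :> int.
Proof.
move=> /andP[b1 b2] /andP[x0 x1]; rewrite /digit /=; apply/eqP.
have x2 : beta * x < 2 by nra.
have x3 : 0 <= beta * x by rewrite mulr_ge0 //; lra.
by rewrite floor_eq; case: (leP 1 (beta * x)) => h /=; rewrite intrD /=; lra.
Qed.

Lemma greedy_expansion beta n x : 1 < beta ->
  (forall k, (k < n)%N -> digit beta k.+1 x = (digit beta k.+1 x == 1)) ->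
  x = word_value beta^-1 (greedy_word beta n x)
      + beta^-1 ^+ n * iter n (beta_transf beta) x.
Proof.
move=> b1; have bN0 : beta != 0 by rewrite gt_eqF // (lt_trans _ b1).
elim: n x => [|n IH] x hd; first by rewrite /= expr0; ring.
rewrite greedy_wordS iterSr [word_value _ _]/=.
have -> : beta^-1 ^+ n.+1 * iter n (beta_transf beta) (beta_transf beta x) =
   beta^-1 * (beta_transf beta x
     - word_value beta^-1 (greedy_word beta n (beta_transf beta x))).
  rewrite exprS {2}(IH (beta_transf beta x)); first by ring.
  by move=> k kn; rewrite -digitS; apply: hd.
have h0 := hd 0%N isT.
have -> : (digit beta 1 x == 1)%:R = (digit beta 1 x)%:~R :> R.
  by rewrite [in RHS]h0; case: (_ == _).
by rewrite /beta_transf /digit /=; field.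
Qed.

Lemma greedy_digit beta n x : 1 < beta < 2 -> 0 <= x < 1 ->
  digit beta n.+1 x = (digit beta n.+1 x == 1).
Proof.
move=> b12; elim: n x => [|n IH] x x01.
  by rewrite digit1_01 //; case: (_ <= _).
by rewrite digitS; apply: IH; exact: beta_transf_itv.
Qed.

Lemma greedy_expansion01 beta n x : 1 < beta < 2 -> 0 <= x < 1 ->
  x = word_value beta^-1 (greedy_word beta n x)
      + beta^-1 ^+ n * iter n (beta_transf beta) x.
Proof.
move=> b12 x01; apply: greedy_expansion; first by case/andP: b12.
by move=> k _; apply: greedy_digit.
Qed.

Lemma iter_beta_transf_itv beta n x : 0 <= x < 1 ->
  0 <= iter n (beta_transf beta) x < 1.
Proof. by case: n => [//|n] _ /=; apply: beta_transf_itv. Qed.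

Lemma num_zero_digitsE beta n x : 1 < beta < 2 -> 0 <= x < 1 ->
  num_zero_digits beta n x = count negb (greedy_word beta n x).
Proof.
move=> b12 x01; rewrite /num_zero_digits /greedy_word count_map (iotaDl 1 0).
rewrite count_map; apply: eq_count => k /=; rewrite add1n greedy_digit //.
by case: (_ == 1).
Qed.

Lemma word_value_zeros b n : word_value b (nseq n false) = 0.
Proof. by elim: n => [//|n IH] /=; rewrite IH addr0 mulr0. Qed.

(** The equation satisfied by beta: iterating past the digits 1^m, the remainder
    is bounded by every power of 1 / beta, so it vanishes. *)
Lemma multinacci_root beta m : 1 < beta < 2 ->
  (forall n : nat, (1 <= n)%N -> digit beta n 1 = if (n <= m)%N then 1 else 0) ->
  word_value beta^-1 (nseq m true) = 1.
Proof.
move=> /andP[b1 b2] hexp; have b0 : 0 < beta by apply: lt_trans b1.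
have bi : 0 <= beta^-1 < 1 by rewrite invr_ge0 ltW //= invf_lt1.
have E k : 1 = word_value beta^-1 (nseq m true)
     + beta^-1 ^+ (m + k.+1) * iter (m + k.+1) (beta_transf beta) 1.
  rewrite {1}(greedy_expansion beta (m + k.+1) 1) //; last first.
    by move=> i _; rewrite hexp //; case: ifP.
  congr (_ + _); have -> : greedy_word beta (m + k.+1) 1 =
      nseq m true ++ nseq k.+1 false.
    apply: (@eq_from_nth _ false).
      by rewrite size_greedy_word size_cat !size_nseq.
    rewrite size_greedy_word => i hi; rewrite nth_mkseq // hexp //.
    rewrite nth_cat size_nseq !nth_nseq.
    by case: (ltnP i m) => im //=; case: ifP.
  by rewrite word_value_cat word_value_zeros mulr0 addr0.
have B k : 0 <= 1 - word_value beta^-1 (nseq m true) <= beta^-1 ^+ k.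
  have := E k; rewrite addnS /=.
  have /andP[] := beta_transf_itv beta (iter (m + k) (beta_transf beta) 1).
  set y := beta_transf _ _ => y0 y1 Ek.
  have -> : 1 - word_value beta^-1 (nseq m true) = beta^-1 ^+ (m + k).+1 * y.
    by rewrite {1}Ek; ring.
  case/andP: bi => bi0 bi1.
  rewrite mulr_ge0 ?exprn_ge0 //=.
  rewrite (le_trans (y := beta^-1 ^+ (m + k).+1)) //.
    by rewrite ler_piMr ?exprn_ge0 // ltW.
  by rewrite ler_wiXn2l // ?ltW // ; lia.
apply/eqP; rewrite eq_sym -subr_eq0; have /andP[c0 _] := B 0%N.
case: (ltgtP 0 (1 - word_value beta^-1 (nseq m true))) c0 => // c0 _.
have [N /(_ N (leqnn N))] := expr_small _ _ bi c0.
by have /andP[_ /le_lt_trans h] := B N; move/h; rewrite ltxx.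
Qed.

Lemma greedy_word_bounded_runs beta m r n x : 1 < beta < 2 ->
  word_value beta^-1 (nseq m true) = 1 -> (r < m)%N ->
  0 <= x < 1 -> x < word_value beta^-1 (nseq r.+1 true) ->
  bounded_runs m r (greedy_word beta n x).
Proof.
move=> b12 hb; have /andP[b1 b2] := b12.
have b0 : 0 < beta by apply: lt_trans b1.
elim: n r x => [//|n IH] r x rm x01 xr; rewrite greedy_wordS /=.
have d1 := digit1_01 _ _ b12 x01.
have T01 := beta_transf_itv beta x.
have mm : (m.-1 < m)%N by lia.
have Tm : beta_transf beta x < word_value beta^-1 (nseq m.-1.+1 true).
  by rewrite prednK ?hb; [case/andP: T01|lia].
rewrite d1; case: leP => bx /=; last exact: IH.
have TE : beta_transf beta x = beta * x - 1.
  rewrite /beta_transf; congr (_ - _); move: d1; rewrite /digit /= => ->.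
  by rewrite bx.
have {xr} : beta * x < 1 + word_value beta^-1 (nseq r true).
  by rewrite -ltr_pdivlMl //.
case: r rm => [|r] rm; first by rewrite /= addr0 ltNge bx.
move=> h; apply: IH => //; first by lia.
by rewrite TE; move: h; rewrite ltrBlDl.
Qed.

(** The greedy digits are characterized by an orbit that stays in [0, 1[. *)
Lemma greedy_digit_of_orbit beta (d : nat -> bool) (y : nat -> R) :
  (forall n, 0 <= y n < 1) ->
  (forall n, y n.+1 = beta * y n - (d n)%:R) ->
  forall n, digit beta n.+1 (y 0%N) = d n /\ iter n (beta_transf beta) (y 0%N) = y n.
Proof.
move=> y01 yS n.
have fl k : Num.floor (beta * y k) = d k.
  apply/eqP; rewrite floor_eq; have := y01 k.+1; rewrite yS.
  by case: (d k) => /=; lra.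
have it k : iter k (beta_transf beta) (y 0%N) = y k.
  elim: k => [//|k IH]; rewrite iterS IH /beta_transf fl yS.
  by case: (d k).
by rewrite /digit /= it fl.
Qed.

Lemma mkseq_cat (T : Type) (f : nat -> T) n k :
  mkseq f (n + k) = mkseq f n ++ mkseq (fun i => f (n + i)%N) k.
Proof.
by rewrite /mkseq iotaD map_cat add0n -[X in iota X k]addn0 iotaDl -map_comp.
Qed.

(** The value of an infinite sequence of digits, as the supremum of the
    values of its prefixes. *)
Definition expansion_value b (d : nat -> bool) : R :=
  sup (range (fun n => word_value b (mkseq d n))).

Lemma word_value_mkseq_le b d n N : 0 <= b -> (n <= N)%N ->
  word_value b (mkseq d n) <= word_value b (mkseq d N).
Proof.
move=> b0 /subnKC <-; rewrite mkseq_cat word_value_cat lerDl.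
by rewrite mulr_ge0 ?exprn_ge0 ?word_value_ge0.
Qed.

Lemma expansion_value_le b d N c : 0 <= b ->
  (forall n, (N <= n)%N -> word_value b (mkseq d n) <= c) ->
  expansion_value b d <= c.
Proof.
move=> b0 h; apply: ge_sup; first by exists (word_value b (mkseq d 0)), 0%N.
move=> _ [n _ <-]; apply: le_trans (h (maxn N n) (leq_maxl _ _)).
exact: word_value_mkseq_le (leq_maxr _ _).
Qed.

Section Expansion.
Variables (beta : R) (m : nat) (d : nat -> bool).
Hypotheses (b12 : 1 < beta < 2) (m3 : (3 <= m)%N).
Hypothesis hb : word_value beta^-1 (nseq m true) = 1.
Hypothesis runs : forall n, bounded_runs m m.-1 (mkseq d n).

Let b0 : 0 < beta. Proof. by case/andP: b12 => b1 _; apply: lt_trans b1. Qed.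
Let bi0 : 0 <= beta^-1. Proof. by rewrite invr_ge0 ltW. Qed.

Lemma le_expansion_value n :
  word_value beta^-1 (mkseq d n) <= expansion_value beta^-1 d.
Proof.
apply: ub_le_sup; last by exists n.
exists 1 => _ [k _ <-].
have := word_value_bounded_runs _ _ _ _ bi0 hb (runs k).
by rewrite prednK ?hb //; lia.
Qed.

(** A pair of zeros after position n keeps the tail of the expansion away
    from its extremal value 1. *)
Lemma expansion_value_gap n k : ~~ d (n + k)%N -> ~~ d (n + k).+1 ->
  expansion_value beta^-1 d <= word_value beta^-1 (mkseq d n)
    + beta^-1 ^+ n * (1 - beta^-1 ^+ (k + 3)).
Proof.
move=> d1 d2; apply: (@expansion_value_le _ _ (n + k + 2)) => // N hN.
have -> : N = (n + (k + (2 + (N - (n + k + 2)))))%N by lia.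
have := runs (n + (k + (2 + (N - (n + k + 2))))).
rewrite mkseq_cat; set f := fun i => d (n + i)%N; set q := (N - _)%N.
have -> : mkseq f (k + (2 + q)) =
    mkseq f k ++ false :: false :: mkseq (fun i => f (k + (2 + i))%N) q.
  rewrite 2!mkseq_cat /f [X in _ ++ (X ++ _)]/mkseq /= addn0 addn1 addnS.
  by rewrite (negbTE d1) (negbTE d2).
move=> hr0; have hr := bounded_runs_catr _ _ _ _ (leqnn _) hr0.
rewrite [leLHS]word_value_cat size_mkseq lerD2l ler_wpM2l ?exprn_ge0 //.
move: (hr); rewrite bounded_runs_cat_zero => /andP[hr1 /= hr2].
have := word_value_gap _ _ _ _ _ bi0 m3 hb hr1 hr2.
rewrite prednK ?hb ?size_mkseq; last by lia.
by rewrite lerBrDr.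
Qed.

Hypothesis zeros : forall n, exists k, ~~ d (n + k)%N /\ ~~ d (n + k).+1.

Lemma expansion_value_greedy : 0 <= expansion_value beta^-1 d < 1 /\
  forall n, digit beta n.+1 (expansion_value beta^-1 d) = d n.
Proof.
pose y n := beta ^+ n * (expansion_value beta^-1 d - word_value beta^-1 (mkseq d n)).
have bN0 : beta != 0 by rewrite gt_eqF.
have y01 n : 0 <= y n < 1.
  rewrite /y mulr_ge0 ?exprn_ge0 ?subr_ge0 ?le_expansion_value ?ltW //=.
  have [k [d1 d2]] := zeros n; have H := expansion_value_gap n k d1 d2.
  apply: (@le_lt_trans _ _ (1 - beta^-1 ^+ (k + 3))).
    by rewrite -ler_pdivlMl ?exprn_gt0 // lerBlDl -exprVn.
  by rewrite ltrBlDr ltrDl exprn_gt0 // invr_gt0.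
have y0 : y 0%N = expansion_value beta^-1 d by rewrite /y expr0 /= subr0 mul1r.
have yS n : y n.+1 = beta * y n - (d n)%:R.
  rewrite /y mkseqS -cats1 word_value_cat size_mkseq /= exprS exprVn.
  by field; rewrite bN0 expf_neq0.
have H := greedy_digit_of_orbit beta d y y01 yS.
split; first by rewrite -y0.
by move=> n; rewrite -y0; case: (H n).
Qed.
End Expansion.

End Greedy.

(** * Upper bound by coverings with cylinders *)

(** The list of the words of length n that satisfy [bounded_runs m r]. *)
Fixpoint bounded_words (m r n : nat) : seq (seq bool) :=
  if n is n'.+1 then
    map (cons false) (bounded_words m m.-1 n') ++
    (if r is r'.+1 then map (cons true) (bounded_words m r' n') else [::])
  else [:: [::]].

Lemma mem_bounded_words (m r : nat) (w : seq bool) :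
  bounded_runs m r w -> w \in bounded_words m r (size w).
Proof.
elim: w r => [//|[] w IH] r /=; last by move/IH=> h; rewrite mem_cat map_f.
by case: r => [//|r] /IH h; rewrite mem_cat [X in _ || X]map_f ?orbT.
Qed.

Lemma size_mem_bounded_words (m r n : nat) (w : seq bool) :
  w \in bounded_words m r n -> size w = n.
Proof.
elim: n r w => [|n IH] r w /=; first by rewrite inE => /eqP ->.
rewrite mem_cat => /orP[/mapP[v /IH <- ->//]|].
by case: r => [//|r] /mapP[v /IH <- ->].
Qed.

Lemma ler_sum_uniq_sub (R : numDomainType) (T : eqType) (s1 s2 : seq T)
    (G : T -> R) : (forall x, 0 <= G x) -> uniq s1 -> {subset s1 <= s2} ->
  \sum_(x <- s1) G x <= \sum_(x <- s2) G x.
Proof.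
move=> G0; elim: s1 s2 => [|x s1 IH] s2 /=.
  by move=> _ _; rewrite big_nil sumr_ge0.
move=> /andP[xs us] h; rewrite big_cons.
rewrite (perm_big _ (perm_to_rem (h x (mem_head _ _)))) big_cons lerD2l.
apply: IH => // y ys; have := h y; rewrite inE ys orbT => /(_ isT).
rewrite (perm_mem (perm_to_rem (h x (mem_head _ _)))) inE => /orP[/eqP yx|//].
by rewrite yx in ys; rewrite ys in xs.
Qed.

Section Upper.
Context {R : realType}.
Implicit Types (t u s a : R) (w : seq bool).

(** The polynomial 1 + t + ... + t^(m-1), denoted Z below. *)
Definition partition_sum (m : nat) t : R := \sum_(j < m) t ^+ j.

(** The product of the weights of the letters: t for 1 and u for 0. *)
Definition word_weight t u w : R := t ^+ count id w * u ^+ count negb w.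

Lemma word_weight_cons t u c w : word_weight t u (c :: w) =
  (if c then t else u) * word_weight t u w.
Proof. by rewrite /word_weight; case: c => /=; rewrite !(add0n, add1n) exprS; ring. Qed.

Lemma word_weight_ge0 t u w : 0 <= t -> 0 <= u -> 0 <= word_weight t u w.
Proof. by move=> t0 u0; rewrite mulr_ge0 ?exprn_ge0. Qed.

Lemma partition_sum_ge1 m t : (0 < m)%N -> 0 <= t -> 1 <= partition_sum m t.
Proof.
case: m => [//|m] _ t0; rewrite /partition_sum big_ord_recl expr0 lerDl.
by rewrite sumr_ge0 // => i _; rewrite exprn_ge0.
Qed.

(** For u = 1 / Z, the vector of the sums 1 + ... + t^r is an eigenvector for the
    eigenvalue 1 of the transfer matrix that adds one letter. *)
Lemma sum_word_weight_le m r n t : (r < m)%N -> 0 < t ->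
  \sum_(w <- bounded_words m r n) word_weight t (partition_sum m t)^-1 w
    <= partition_sum r.+1 t.
Proof.
move=> rm t0; have t00 := ltW t0.
elim: n r rm => [|n IH] r rm.
  by rewrite /= big_seq1 /word_weight !expr0 mulr1 partition_sum_ge1.
rewrite big_cat big_map /=.
have Z0 : 0 < partition_sum m t.
  by apply: lt_le_trans (partition_sum_ge1 _ _ _ t00); rewrite ?ltr01; lia.
under eq_bigr do rewrite word_weight_cons.
rewrite -mulr_sumr.
have h0 : (partition_sum m t)^-1 * \sum_(w <- bounded_words m m.-1 n)
     word_weight t (partition_sum m t)^-1 w <= 1.
  rewrite ler_pdivrMl // mulr1; have := IH m.-1; rewrite prednK; last by lia.
  by apply; lia.
case: r rm => [|r] rm.
  by rewrite big_nil addr0 /partition_sum big_ord1 expr0.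
rewrite big_map; under [X in _ + X]eq_bigr do rewrite word_weight_cons.
rewrite -mulr_sumr.
have -> : partition_sum r.+2 t = 1 + t * partition_sum r.+1 t.
  rewrite /partition_sum big_ord_recl expr0 mulr_sumr; congr (_ + _).
  by apply: eq_bigr => i _; rewrite exprS.
by rewrite lerD // ler_pM2l // IH //; lia.
Qed.

(** The points of [0, 1[ whose expansion starts with w. *)
Definition cylinder (beta : R) w : set R :=
  [set y | 0 <= y < 1 /\ greedy_word beta (size w) y = w].

Lemma diam_cylinder beta w : 1 < beta < 2 ->
  (diam (cylinder beta w) <= (beta^-1 ^+ size w)%:E)%E.
Proof.
move=> b12; apply: ge_ereal_sup => _ [[x y] [[x01 xw] [y01 yw]] <-] /=.
rewrite lee_fin (greedy_expansion01 _ (size w) x b12 x01).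
rewrite (greedy_expansion01 _ (size w) y b12 y01) xw yw.
have -> (p q r c : R) : p + c * q - (p + c * r) = c * (q - r) by ring.
have bi : 0 <= beta^-1 by rewrite invr_ge0; case/andP: b12; lra.
rewrite normrM ger0_norm ?exprn_ge0 // ler_piMr ?exprn_ge0 //.
have /andP[] := iter_beta_transf_itv beta (size w) x x01.
have /andP[] := iter_beta_transf_itv beta (size w) y y01.
by rewrite ler_norml; lra.
Qed.

Lemma diam_ge0 (U : set R) : U !=set0 -> (0 <= diam U)%E.
Proof.
move=> [x Ux]; apply: ereal_sup_ubound; exists (x, x) => //=.
by rewrite subrr normr0.
Qed.

Lemma diam_pow_le s (U : set R) (r : R) : 0 <= s ->
  (diam U <= r%:E)%E -> (diam_pow s U <= (r `^ s)%:E)%E.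
Proof.
move=> s0 h; rewrite /diam_pow; case: ifPn => [_|/set0P U0].
  by rewrite lee_fin powR_ge0.
rewrite -poweR_EFin; have d0 := diam_ge0 U U0.
apply: gt0_ler_poweR => //; rewrite in_itv /= ?d0 ?leey //.
by rewrite andbT (le_trans d0).
Qed.

Lemma diam_pow_ge0 s (U : set R) : (0 <= diam_pow s U)%E.
Proof. by rewrite /diam_pow; case: ifP => // _; rewrite poweR_ge0. Qed.

Lemma hausdorff_pre_ge0 s delta (E : set R) : (0 <= hausdorff_pre s delta E)%E.
Proof.
apply: le_ereal_inf_tmp => _ [U _ <-]; apply: nneseries_ge0 => n _ _.
exact: diam_pow_ge0.
Qed.

Lemma nneseries_le_partial (u : nat -> \bar R) (B : \bar R) :
  (forall i, (0 <= u i)%E) ->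
  (forall I, (\sum_(0 <= i < I) u i <= B)%E) ->
  (\sum_(0 <= i <oo) u i <= B)%E.
Proof.
move=> u0 h; apply: lime_le; first by apply: is_cvg_nneseries.
exact: nearW.
Qed.

(** Covering by all the cylinders of length at least N that satisfy a given
    condition. *)
Lemma hausdorff_pre_cylinders beta m s delta N (good : pred (seq bool))
    (g : seq bool -> R) (B : R) (E : set R) :
  1 < beta < 2 -> 0 <= s -> beta^-1 ^+ N <= delta -> 0 < delta ->
  (forall x, E x -> 0 <= x < 1 /\ exists n, [/\ (N <= n)%N,
     bounded_runs m m.-1 (greedy_word beta n x) & good (greedy_word beta n x)]) ->
  (forall w, 0 <= g w) ->
  (forall w, good w -> (beta^-1 ^+ size w) `^ s <= g w) ->
  (forall K, \sum_(n <- iota N K) \sum_(w <- bounded_words m m.-1 n) g w <= B) ->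
  (hausdorff_pre s delta E <= B%:E)%E.
Proof.
move=> b12 s0 bN delta0 cov g0 hg hB.
pose P w := [&& good w, (N <= size w)%N & bounded_runs m m.-1 w].
pose U i := if pickle_inv i is Some w then
  if P w then cylinder beta w else set0 else set0.
have bi : 0 <= beta^-1 <= 1.
  by case/andP: b12 => b1 _; rewrite invr_ge0 invf_le1; lra.
apply: (@le_trans _ _ (\sum_(0 <= i <oo) diam_pow s (U i))%E).
  apply: ereal_inf_lbound; exists U => //; split.
    move=> x /cov[x01 [n [Nn hr hw]]]; exists (pickle (greedy_word beta n x)) => //.
    rewrite /U pickleK_inv /P hw hr size_greedy_word Nn /=; split=> //.
    by rewrite size_greedy_word.
  move=> i; have d0 : (diam (set0 : set R) <= delta%:E)%E.
    by apply: ge_ereal_sup => z [[x y] []].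
  rewrite /U; case: pickle_inv => [w|//]; case: ifPn => // /and3P[_ Nw _].
  apply: le_trans (diam_cylinder _ w b12) _; rewrite lee_fin.
  apply: le_trans bN; case/andP: bi => bi0 bi1; exact: ler_wiXn2l.
apply: nneseries_le_partial => [i|I]; first exact: diam_pow_ge0.
pose G w := if P w then g w else 0.
have G0 w : 0 <= G w by rewrite /G; case: ifP.
apply: (@le_trans _ _ (\sum_(0 <= i < I) (oapp G 0 (pickle_inv i))%:E)%E).
  apply: lee_sum => i _; rewrite /U; case: pickle_inv => [w|] /=; last first.
    by rewrite /diam_pow eqxx.
  rewrite /G; case: ifPn => [/and3P[gw _ _]|_]; last by rewrite /diam_pow eqxx.
  apply: le_trans (diam_pow_le _ _ _ s0 (diam_cylinder _ w b12)) _.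
  by rewrite lee_fin hg.
rewrite sumEFin lee_fin -big_pmap /index_iota subn0.
rewrite (bigID P) /= [X in _ + X]big1 ?addr0; last first.
  by move=> w /negbTE Pw; rewrite /G Pw.
rewrite -big_filter; set L := (X in \sum_(w <- X) _).
pose K := (\max_(w <- L) size w).+1.
apply: le_trans (hB K); rewrite -(big_map (bounded_words m m.-1) xpredT
  (fun r => \sum_(w <- r) g w)) -big_flatten.
apply: (@le_trans _ _ (\sum_(w <- L) g w)).
  by apply: ler_sum => w _; rewrite /G; case: ifP.
apply: ler_sum_uniq_sub => //.
  by rewrite filter_uniq // (pmap_uniq pickle_invK) // iota_uniq.
move=> w wL; apply/flattenP; exists (bounded_words m m.-1 (size w)).
  apply: map_f; rewrite mem_iota; have := @leq_bigmax_seq _ L xpredT size w wL isT.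
  move: wL; rewrite mem_filter => /andP[/and3P[_ -> _] _] /= h.
  by rewrite addnS ltnS (leq_trans h) // leq_addl.
by apply: mem_bounded_words; move: wL; rewrite mem_filter => /andP[/and3P[]].
Qed.

Lemma sum_geometric_le (rho : R) N K : 0 <= rho < 1 ->
  \sum_(n <- iota N K) rho ^+ n <= rho ^+ N / (1 - rho).
Proof.
move=> /andP[r0 r1]; have r1' : 0 < 1 - rho by rewrite subr_gt0.
elim: K N => [|K IH] N /=; first by rewrite big_nil divr_ge0 ?exprn_ge0 // ltW.
rewrite big_cons (le_trans (lerD (lexx _) (IH N.+1))) // exprS.
by rewrite le_eqVlt; apply/orP; left; apply/eqP; field; rewrite gt_eqF.
Qed.

(** The exponential growth rate that the weights t and 1 / Z allow for the number
    of words with frequency a of zeros. *)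
Definition pressure (m : nat) a t : R :=
  a * ln (partition_sum m t) - (1 - a) * ln t.

Lemma hausdorff_measure_freq_set_eq0 beta m a t s :
  1 < beta < 2 -> word_value beta^-1 (nseq m true) = 1 -> 0 < t -> 0 <= s ->
  pressure m a t < s * ln beta -> hausdorff_measure s (freq_set beta a) = 0%E.
Proof.
move=> b12 hb t0 s0 hs.
have m0 : (0 < m)%N.
  by case: (m) hb => //= /esym/eqP; rewrite oner_eq0.
have mm : (m.-1 < m)%N by rewrite prednK.
have /andP[b1 b2] := b12; have b0 : 0 < beta by apply: lt_trans b1.
have bi : 0 <= beta^-1 < 1 by rewrite invr_ge0 ltW //= invf_lt1.
have Z0 : 0 < partition_sum m t.
  by apply: lt_le_trans (partition_sum_ge1 _ _ m0 (ltW t0)).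
(* eta is the margin in the exponent; half of it pays for the deviation of the
   frequency, the other half makes the series over the lengths converge. *)
pose eta := s * ln beta - pressure m a t.
have eta0 : 0 < eta by rewrite subr_gt0.
pose kappa := `|ln t + ln (partition_sum m t)| + 1.
have kappa0 : 0 < kappa by rewrite ltr_wpDl.
pose dev := eta / 2 / kappa.
have dev0 : 0 < dev by rewrite !divr_gt0.
pose rho := expR (- (eta / 2)).
have rho01 : 0 <= rho < 1 by rewrite expR_ge0 expR_lt1; lra.
pose good w := `|(count negb w)%:R - a * (size w)%:R| <= dev * (size w)%:R.
pose g w := word_weight t (partition_sum m t)^-1 w * rho ^+ size w.
have g0 w : 0 <= g w.
  rewrite mulr_ge0 ?exprn_ge0 ?expR_ge0 //.
  by rewrite word_weight_ge0 ?invr_ge0 ?ltW.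
have good_le w : good w -> (beta^-1 ^+ size w) `^ s <= g w.
  rewrite /good => hw.
  have sz : (size w)%:R = (count id w)%:R + (count negb w)%:R :> R.
    by rewrite -natrD -(count_predC id w).
  have -> : beta^-1 ^+ size w = expR (- ((size w)%:R * ln beta)).
    by rewrite expRN expRM_natl lnK ?exprVn.
  rewrite -expRM /g /word_weight exprVn.
  rewrite -{1}(lnK (t0 : t \is Num.pos)) -expRM_natl.
  rewrite -{1}(lnK (Z0 : partition_sum m t \is Num.pos)) -expRM_natl.
  rewrite /rho -expRM_natl -expRN -!expRD ler_expR.
  move: hw; rewrite -subr_ge0 => hw.
  have hk : ((count negb w)%:R - a * (size w)%:R) * (ln t + ln (partition_sum m t))
      <= (size w)%:R * (eta / 2).
    apply: le_trans (ler_norm _) _; rewrite normrM.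
    apply: (@le_trans _ _ ((dev * (size w)%:R) * kappa)).
      by apply: ler_pM => //; [move: hw; rewrite subr_ge0|rewrite lerDl].
    rewrite le_eqVlt; apply/orP; left; apply/eqP; rewrite /dev; field.
    by rewrite gt_eqF.
  have E : s * ln beta = eta + a * ln (partition_sum m t) - (1 - a) * ln t.
    by rewrite /eta /pressure; ring.
  rewrite [leLHS](_ : _ = - ((size w)%:R * (s * ln beta))); last by ring.
  rewrite E; move: hk; rewrite sz; lra.
have cover N delta : 0 < delta -> beta^-1 ^+ N <= delta ->
   (hausdorff_pre s delta (freq_set beta a)
     <= (partition_sum m t * (rho ^+ N / (1 - rho)))%:E)%E.
  move=> delta0 bN.
  apply: (@hausdorff_pre_cylinders beta m s delta N good g) => //.
    move=> x [x01]; move/cvgrPdist_le => /(_ _ dev0) [n0 _ hn]; split=> //.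
    exists (maxn N n0).+1; split; first by rewrite leqW ?leq_maxl.
      apply: (greedy_word_bounded_runs beta m m.-1 _ x b12 hb mm x01).
      by rewrite prednK // hb; case/andP: x01.
    have := hn (maxn N n0).+1; rewrite /= leqW ?leq_maxr // => /(_ isT).
    rewrite num_zero_digitsE // /good size_greedy_word.
    set z := (count _ _)%:R; set n := _.+1%:R => h.
    have n0' : 0 < n by rewrite /n ltr0n.
    have -> : z - a * n = - ((a - z / n) * n) by field; rewrite gt_eqF.
    by rewrite normrN normrM (gtr0_norm n0') ler_pM2r.
  move=> K; apply: (@le_trans _ _ (\sum_(n <- iota N K) partition_sum m t * rho ^+ n)).
    apply: ler_sum => n _.
    rewrite (@eq_big_seq _ _ _ _ _ _
      (fun w => word_weight t (partition_sum m t)^-1 w * rho ^+ n)).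
      rewrite -mulr_suml ler_wpM2r ?exprn_ge0 ?expR_ge0 //.
      apply: le_trans (sum_word_weight_le m m.-1 n t mm t0) _.
      by rewrite prednK.
    by move=> w /size_mem_bounded_words wn; rewrite /g wn.
  by rewrite -mulr_sumr; apply: ler_wpM2l; [exact: ltW|exact: sum_geometric_le].
have pre0 delta : 0 < delta -> hausdorff_pre s delta (freq_set beta a) = 0%E.
  move=> delta0; apply/eqP; rewrite eq_le hausdorff_pre_ge0 andbT.
  apply/lee_addgt0Pr => e e0; rewrite add0e.
  have rho1 : 0 < 1 - rho by rewrite subr_gt0; case/andP: rho01.
  have [N1 h1] := expr_small _ _ bi delta0.
  have e1 : 0 < e * (1 - rho) / partition_sum m t by rewrite divr_gt0 ?mulr_gt0.
  have [N2 h2] := expr_small _ _ rho01 e1.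
  apply: le_trans (cover (maxn N1 N2) delta delta0 _) _.
    by rewrite ltW // h1 // leq_maxl.
  rewrite lee_fin; have := h2 _ (leq_maxr N1 N2).
  rewrite ltr_pdivlMr // => h; rewrite mulrA ler_pdivrMr // mulrC ltW //.
apply/eqP; rewrite eq_le; apply/andP; split.
  by apply: ge_ereal_sup => _ [delta delta0 <-]; rewrite pre0.
apply: ereal_sup_ubound; exists 1 => //=; exact: pre0.
Qed.

Lemma hausdorff_dim_ge0 (E : set R) : (0 <= hausdorff_dim E)%E.
Proof. by apply: le_ereal_inf_tmp => _ [s [s0 _] <-]; rewrite lee_fin. Qed.

Lemma hausdorff_dim_le (E : set R) (c : R) : 0 <= c ->
  (forall s, c < s -> hausdorff_measure s E = 0%E) -> (hausdorff_dim E <= c%:E)%E.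
Proof.
move=> c0 h; apply/lee_addgt0Pr => e e0.
apply: ereal_inf_lbound; exists (c + e) => //=; split; first by lra.
by apply: h; lra.
Qed.

Lemma hausdorff_dim_freq_set_le beta m a t (M : R) :
  1 < beta < 2 -> word_value beta^-1 (nseq m true) = 1 -> 0 < t ->
  pressure m a t <= M -> 0 <= M ->
  (hausdorff_dim (freq_set beta a) <= ((ln beta)^-1 * M)%:E)%E.
Proof.
move=> b12 hb t0 hM M0; have lb : 0 < ln beta by apply: ln_gt0; case/andP: b12.
have c0 : 0 <= (ln beta)^-1 * M by rewrite mulr_ge0 // invr_ge0 ltW.
apply: hausdorff_dim_le => // s hs.
apply: (hausdorff_measure_freq_set_eq0 _ m _ t) => //.
  by apply: ltW; apply: le_lt_trans hs.
by apply: le_lt_trans hM _; rewrite -ltr_pdivrMr // mulrC.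
Qed.

End Upper.

(** * Counting arrangements of blocks *)

Lemma sum_count_undup (T : eqType) (s : seq T) :
  (\sum_(x <- undup s) count_mem x s)%N = size s.
Proof.
rewrite -(perm_size (perm_count_undup s)) size_flatten sumnE !big_map.
by apply: eq_bigr => x _; rewrite size_nseq.
Qed.

(** The number of arrangements of a multiset is a multinomial coefficient. *)
Lemma size_permutations_mul (T : eqType) (r s : seq T) :
  uniq r -> {subset s <= r} ->
  (size (permutations s) * \prod_(x <- r) (count_mem x s)`!)%N = (size s)`!.
Proof.
move=> ur; move: {2}(size s) (erefl (size s)) => n.
elim: n s => [|n IH] s sn sr.
  by rewrite (size0nil sn) /= mul1n big1.
have s0 : (0 < size s)%N by rewrite sn.
rewrite (perm_size (permutationsE s0)) size_allpairs_dep sumnE big_map.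
rewrite big_distrl /= sn factS -sn -sum_count_undup big_distrl /=.
apply: eq_big_seq => x; rewrite mem_undup => xs.
have szr : size (rem x s) = n by rewrite size_rem // sn.
have subr : {subset rem x s <= r} by move=> y /mem_rem; apply: sr.
rewrite -szr -(IH _ szr subr).
rewrite mulnCA; congr (_ * _)%N.
rewrite (bigD1_seq x) ?sr //= [in RHS](bigD1_seq x) ?sr //= mulnA.
congr (_ * _)%N.
  rewrite count_rem xs /= eqxx subn1.
  have : (0 < count_mem x s)%N by rewrite -has_count has_pred1.
  by case: (count_mem x s) => [//|k] _; rewrite factS.
apply: eq_bigr => y yx; rewrite count_rem xs /=.
by rewrite [x == y]eq_sym (negbTE yx) subn0.
Qed.

Section Entropy.
Context {R : realType}.
Implicit Types (p : nat -> R) (y : R).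

Lemma ln_fact_ge n y : 0 < y -> n%:R * ln y - y <= ln (n`!%:R : R).
Proof.
move=> y0; have h : y ^+ n / n`!%:R <= expR y.
  case: n => [|n]; first by rewrite expr0 fact0 divr1 -(expR0 R) ler_expR ltW.
  by apply: le_trans (expR_ge1Dxn n (ltW y0)); rewrite lerDr.
have f0 : 0 < n`!%:R :> R by rewrite ltr0n fact_gt0.
rewrite lerBlDr -ler_expR expRD lnK // expRM_natl lnK //.
by rewrite mulrC -ler_pdivrMr.
Qed.

Lemma ln_ge_subV y : 0 < y -> 1 - y^-1 <= ln y.
Proof.
move=> y0; have := @le_ln1Dx R (y^-1 - 1); rewrite ltrBDr addrC subrr invr_gt0.
move=> /(_ y0); rewrite addrCA subrr addr0 lnV ?posrE // => h.
by rewrite -lerN2 opprB.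
Qed.

Lemma ln_factS_le n :
  ln (n.+1`!%:R : R) <= n.+1%:R * ln n.+1%:R - n.+1%:R + 1 + ln n.+1%:R.
Proof.
elim: n => [|n IH]; first by rewrite factS fact0 muln1 ln1 mulr0 add0r addr0 addNr.
have n0 : 0 < n.+1%:R :> R by rewrite ltr0n.
have n1 : 0 < n.+2%:R :> R by rewrite ltr0n.
have : 1 - (n.+2%:R / n.+1%:R)^-1 <= ln (n.+2%:R / n.+1%:R :> R).
  by apply: ln_ge_subV; rewrite divr_gt0.
rewrite ln_div ?posrE // invf_div => h.
have E : (1 - n.+1%:R / n.+2%:R) * n.+2%:R = 1 :> R.
  by rewrite mulrBl mul1r divfK ?gt_eqF // -(natr1 n.+1) addrAC subrr add0r.
have {}h : 1 <= (ln n.+2%:R - ln n.+1%:R) * n.+2%:R :> R.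
  by move: h; rewrite -(ler_pM2r n1) E.
rewrite factS natrM lnM ?posrE ?ltr0n ?fact_gt0 //.
move: IH h; rewrite -(natr1 n.+1); lra.
Qed.

Lemma ln_fact_le n y (N : nat) : n%:R <= y -> (n <= N)%N ->
  ln (n`!%:R : R) <= n%:R * ln y - n%:R + 1 + ln N.+1%:R.
Proof.
case: n => [|n] ny nN.
  by rewrite fact0 ln1 mul0r subr0 add0r addr_ge0 // ln_ge0 // ler1n.
apply: le_trans (ln_factS_le n) _.
have n0 : 0 < n.+1%:R :> R by rewrite ltr0n.
have y0 : 0 < y by apply: lt_le_trans ny.
rewrite lerD //; last by rewrite ler_ln ?posrE ?ltr0n // ler_nat ltnW.
by rewrite !lerD2r ler_pM2l // ler_ln ?posrE.
Qed.

(** The entropy of block frequencies of total a.  A term with p j = 0 is 0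
    thanks to the factor p j. *)
Definition block_entropy (m : nat) (a : R) p : R :=
  \sum_(j < m) p j * ln (a / p j).

(** The multiset of blocks used at stage k: the integral part of k * p j is the
    number of copies of j. *)
Definition stage_multiset (m : nat) p (k : nat) : seq nat :=
  flatten [seq nseq (Num.truncn (k%:R * p j)) j | j <- iota 0 m].

Lemma big_stage_multiset m p k (F : nat -> R) :
  \sum_(j <- stage_multiset m p k) F j
    = \sum_(j < m) (Num.truncn (k%:R * p j))%:R * F j.
Proof.
rewrite big_flatten big_map (_ : iota 0 m = index_iota 0 m) ?big_mkord; last first.
  by rewrite /index_iota subn0.
apply: eq_bigr => j _; rewrite big_nseq; set n := Num.truncn _.
by rewrite mulr_natl; elim: n => [//|n IH]; rewrite /= IH mulrS.
Qed.

Lemma stage_multiset_lt m p k : all (fun j => j < m)%N (stage_multiset m p k).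
Proof.
apply/allP => j /flattenP[s /mapP[i]]; rewrite mem_iota add0n => /andP[_ im] ->.
by move/nseqP => [-> _].
Qed.

Lemma count_stage_multiset m p k j : (j < m)%N ->
  count_mem j (stage_multiset m p k) = Num.truncn (k%:R * p j).
Proof.
move=> jm; rewrite count_flatten sumnE !big_map (bigD1_seq j) ?iota_uniq //=; last first.
  by rewrite mem_iota.
rewrite count_nseq /= eqxx mul1n big1_seq ?addn0 // => i /andP[ij _].
by rewrite count_nseq /= (negbTE ij).
Qed.

Lemma size_stage_multiset m p k :
  (size (stage_multiset m p k))%:R = \sum_(j < m) (Num.truncn (k%:R * p j))%:R :> R.
Proof.
rewrite -sum1_size natr_sum big_stage_multiset.
by apply: eq_bigr => j _; rewrite mulr1.
Qed.

(** The number of arrangements of the blocks of stage k. *)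
Definition stage_choices m p k : nat := size (permutations (stage_multiset m p k)).

Lemma stage_choices_gt0 m p k : (0 < stage_choices m p k)%N.
Proof.
have := mem_permutations (stage_multiset m p k) (stage_multiset m p k).
by rewrite perm_refl /stage_choices; case: (permutations _).
Qed.

Lemma ln_stage_choices m p k : ln ((stage_choices m p k)%:R : R) =
  ln ((size (stage_multiset m p k))`!%:R)
   - \sum_(j < m) ln ((Num.truncn (k%:R * p j))`!%:R).
Proof.
have h := @size_permutations_mul _ (iota 0 m) (stage_multiset m p k) (iota_uniq _ _).
rewrite -h; last first.
  by move=> j /(allP (stage_multiset_lt m p k)) jm; rewrite mem_iota.
rewrite natrM (_ : iota 0 m = index_iota 0 m) ?big_mkord ?natr_prod; last first.
  by rewrite /index_iota subn0.
rewrite lnM ?posrE ?ltr0n ?stage_choices_gt0 //; last first.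
  by apply: prodr_gt0 => j _; rewrite ltr0n fact_gt0.
have -> : ln (\prod_(j < m) (count_mem (j : nat) (stage_multiset m p k))`!%:R) =
   \sum_(j < m) ln ((Num.truncn (k%:R * p j))`!%:R) :> R.
  transitivity (\sum_(j < m) ln ((count_mem (j : nat) (stage_multiset m p k))`!%:R) : R).
    pose Q (x y : R) := 0 < x /\ ln x = y.
    suff [] : Q (\prod_(j < m) (count_mem (j : nat) (stage_multiset m p k))`!%:R)
      (\sum_(j < m) ln ((count_mem (j : nat) (stage_multiset m p k))`!%:R)) by [].
    apply: (big_ind2 Q); first by split; rewrite ?ln1.
      by move=> x1 x2 y1 y2 [x10 <-] [y10 <-]; split; rewrite ?mulr_gt0 // lnM.
    by move=> j _; split; rewrite // ltr0n fact_gt0.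
  by apply: eq_bigr => j _; rewrite count_stage_multiset.
by rewrite addrK.
Qed.

Section Bounds.
Variables (m : nat) (a : R) (p : nat -> R).
Hypotheses (a0 : 0 < a) (a1 : a <= 1).
Hypothesis p0 : forall j, (j < m)%N -> 0 <= p j.
Hypothesis pa : \sum_(j < m) p j = a.

Lemma le_total_freq j : (j < m)%N -> p j <= a.
Proof.
move=> jm; rewrite -pa (bigD1 (Ordinal jm)) //= lerDl.
by apply: sumr_ge0 => i _; apply: p0.
Qed.

Lemma ln_stage_choices_ge k :
  k%:R * block_entropy m a p
    - \sum_(j < m) (ln (a / p j) + 2 + ln k.+1%:R)
  <= ln ((stage_choices m p k)%:R : R).
Proof.
have lnap j : (j < m)%N -> 0 <= ln (a / p j).
  move=> jm; have := p0 j jm; rewrite le_eqVlt => /predU1P[<-|pj].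
    by rewrite invr0 mulr0 ln0.
  by rewrite ln_ge0 // ler_pdivlMr // mul1r le_total_freq.
case: k => [|k].
  rewrite mul0r sub0r; apply: (@le_trans _ _ 0).
    rewrite oppr_le0 sumr_ge0 // => j _; have := lnap j (ltn_ord j).
    by rewrite ln1; lra.
  by rewrite ln_ge0 // ler1n stage_choices_gt0.
set n := k.+1; have n0 : 0 < n%:R :> R by rewrite ltr0n.
have na : 0 < n%:R * a by rewrite mulr_gt0.
rewrite ln_stage_choices.
apply: le_trans (lerD (ln_fact_ge _ _ na) (lexx _)).
have naE : n%:R * a = \sum_(j < m) n%:R * p j by rewrite -pa mulr_sumr.
rewrite size_stage_multiset; set L := ln (n%:R * a).
rewrite naE mulr_suml.
rewrite /block_entropy mulr_sumr -!sumrB; apply: ler_sum => j _.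
have pj0 := p0 j (ltn_ord j); have pja := le_total_freq j (ltn_ord j).
have npj : 0 <= n%:R * p j by rewrite mulr_ge0 // ltW.
have /andP[] := truncn_itv npj; set t := Num.truncn _ => t1 t2.
have tn : (t <= n)%N.
  rewrite -(ler_nat R) (le_trans t1) // ler_piMr ?(ltW n0) //.
  exact: le_trans a1.
have H1 := ln_fact_le t (n%:R * p j) n t1 tn.
have H2 : n%:R * (p j * ln (a / p j)) - ln (a / p j)
     <= t%:R * L - t%:R * ln (n%:R * p j).
  move: pj0; rewrite le_eqVlt => /predU1P[pj|pj].
    have t00 : t%:R = 0 :> R.
      by apply/eqP; rewrite eq_le ler0n andbT (le_trans t1) // -pj mulr0.
    by rewrite t00 -pj invr0 !mulr0 ln0 // !mul0r mulr0 subrr.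
  rewrite -mulrBr; have -> : L - ln (n%:R * p j) = ln (a / p j).
    by rewrite ln_div ?posrE // /L !lnM ?posrE //; ring.
  have := lnap j (ltn_ord j).
  move: t2; rewrite -natr1; nra.
move: H1 H2 t2; rewrite -natr1; lra.
Qed.

(** The error of order log k in the previous bound is absorbed by any loss on
    the slope. *)
Lemma ln_stage_choices_linear h : h < block_entropy m a p ->
  exists D, forall k, h * k%:R - D <= ln ((stage_choices m p k)%:R : R).
Proof.
move=> hlt.
pose K := \sum_(j < m) (ln (a / p j) + 2).
pose e := (block_entropy m a p - h) / m.+1%:R.
have m0 : 0 < m.+1%:R :> R by rewrite ltr0n.
have e0 : 0 < e by rewrite divr_gt0 // subr_gt0.
exists (K + m%:R * (e - ln e)) => k.
apply: le_trans (ln_stage_choices_ge k).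
rewrite big_split /= -/K sumr_const card_ord -mulr_natl.
have k0 : 0 < k.+1%:R :> R by rewrite ltr0n.
have : ln (e * k.+1%:R) < e * k.+1%:R by apply: ln_sublinear; rewrite mulr_gt0.
rewrite lnM ?posrE // => /ltW hk.
have {}hk : m%:R * ln k.+1%:R <= m%:R * (e * k.+1%:R - ln e).
  by rewrite ler_wpM2l // lerBrDl.
have he : m%:R * e <= block_entropy m a p - h.
  rewrite /e mulrCA ler_piMr ?subr_ge0 ?ltW //.
  by rewrite ltr_pdivrMr // mul1r ltr_nat.
have {}he : m%:R * e * k%:R <= (block_entropy m a p - h) * k%:R by rewrite ler_wpM2r.
move: hk he; rewrite -(natr1 k).
lra.
Qed.
End Bounds.
End Entropy.

(** * Points coded by a real parameter *)

(** The concatenation of the first K terms of a sequence of words. *)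
Definition concat (T : Type) (W : nat -> seq T) (K : nat) : seq T :=
  flatten (mkseq W K).

Lemma concatS (T : Type) (W : nat -> seq T) K : concat T W K.+1 = concat T W K ++ W K.
Proof. by rewrite /concat mkseqS -cats1 flatten_cat /= cats0. Qed.

Lemma concatD (T : Type) (W : nat -> seq T) K L :
  exists v, concat T W (K + L) = concat T W K ++ v.
Proof. by rewrite /concat mkseq_cat flatten_cat; eexists. Qed.

Lemma size_concat (T : Type) (W : nat -> seq T) K :
  size (concat T W K) = (\sum_(i < K) size (W i))%N.
Proof.
elim: K => [|K IH]; first by rewrite big_ord0.
by rewrite concatS size_cat IH big_ord_recr.
Qed.

(** The infinite concatenation of nonempty words: its n-th letter already
    occurs in the concatenation of the first n + 1 words. *)
Definition concat_seq (W : nat -> seq bool) (n : nat) : bool :=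
  nth false (concat bool W n.+1) n.

Section ConcatSeq.
Variable W : nat -> seq bool.
Hypothesis W0 : forall k, (0 < size (W k))%N.

Lemma leq_size_concat K : (K <= size (concat bool W K))%N.
Proof. by elim: K => [//|K IH]; rewrite concatS size_cat; have := W0 K; lia. Qed.

Lemma mkseq_concat_seq K :
  mkseq (concat_seq W) (size (concat bool W K)) = concat bool W K.
Proof.
apply: (@eq_from_nth _ false) => [|n]; rewrite size_mkseq // => nK.
rewrite nth_mkseq // /concat_seq; have hn := leq_size_concat n.+1.
case/orP: (leq_total K n.+1) => /subnKC <-.
  by have [v ->] := concatD bool W K (n.+1 - K); rewrite nth_cat nK.
have [v E] := concatD bool W n.+1 (K - n.+1).
by rewrite [in RHS]E nth_cat hn.
Qed.

(** The prefix that ends inside the K-th word, and the letter that follows. *)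
Lemma concat_seqE K u c v : W K = u ++ c :: v ->
  mkseq (concat_seq W) (size (concat bool W K) + size u) = concat bool W K ++ u /\
  concat_seq W (size (concat bool W K) + size u) = c.
Proof.
move=> E; have := mkseq_concat_seq K.+1; rewrite concatS E size_cat => H.
have H2 := congr1 (take (size (concat bool W K) + size u)) H.
have H3 := congr1 (nth false ^~ (size (concat bool W K) + size u)%N) H.
move: H2 H3; rewrite size_cat /= addnA => H2 H3; split.
  move: H2; rewrite mkseq_cat take_size_cat ?size_mkseq // => ->.
  by rewrite catA take_size_cat // size_cat.
move: H3; rewrite nth_mkseq; last by lia.
by move=> ->; rewrite catA nth_cat size_cat ltnn subnn.
Qed.

End ConcatSeq.

Lemma first_difference (u v : seq bool) : size u = size v -> u != v ->
  exists q c r r', [/\ u = q ++ c :: r, v = q ++ (~~ c) :: r' & size r = size r'].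
Proof.
elim: u v => [|x u IH] [|y v] //= [] suv uv.
have [xy|xy] := eqVneq x y; last first.
  by exists [::], x, u, v; split=> //=; case: (x) (y) xy => [] [].
have : u != v by apply: contraNneq uv => ->; rewrite xy.
move/(IH v suv) => [q [c [r [r' [-> -> rr]]]]].
by exists (x :: q), c, r, r'; rewrite xy.
Qed.

Lemma size_blocks s : size (flatten (map block s)) = (\sum_(j <- s) j.+1)%N.
Proof.
elim: s => [|j s IH]; first by rewrite big_nil.
rewrite [flatten _](_ : _ = block j ++ flatten (map block s)) //.
by rewrite size_cat IH big_cons size_block.
Qed.

Lemma zeros_blocks s : count negb (flatten (map block s)) = size s.
Proof.
elim: s => [//|j s IH].
rewrite [flatten _](_ : _ = block j ++ flatten (map block s)) //.
by rewrite count_cat zeros_block IH.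
Qed.

Section Construction.
Context {R : realType}.
Variables (m : nat) (p : nat -> R).

(** The expansion of t in [0, 1[ in the mixed radix system whose k-th base is
    the number of arrangements of stage k: [radix_rem t k] is the rescaled
    remainder before the k-th digit. *)
Fixpoint radix_rem (t : R) (k : nat) : R :=
  if k is k'.+1 then
    let y := (stage_choices m p k')%:R * radix_rem t k' in y - (Num.truncn y)%:R
  else t.

Definition radix_digit t k : nat :=
  Num.truncn ((stage_choices m p k)%:R * radix_rem t k).

Lemma radix_rem_itv t k : 0 <= t < 1 -> 0 <= radix_rem t k < 1.
Proof.
move=> t01; elim: k => [//|k /andP[IH _]] /=.
have h : 0 <= (stage_choices m p k)%:R * radix_rem t k by rewrite mulr_ge0.
by have /andP[] := truncn_itv h; rewrite -natr1; lra.
Qed.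

Lemma radix_digit_lt t k : 0 <= t < 1 -> (radix_digit t k < stage_choices m p k)%N.
Proof.
move=> /(radix_rem_itv t k)/andP[h1 h2]; rewrite /radix_digit truncn_lt_nat.
  by rewrite gtr_pMr // ltr0n stage_choices_gt0.
by rewrite mulr_ge0.
Qed.

Lemma radix_dist t t' k : 0 <= t < 1 -> 0 <= t' < 1 ->
  (forall i, (i < k)%N -> radix_digit t i = radix_digit t' i) ->
  `|t - t'| * \prod_(i < k) (stage_choices m p i)%:R <= 1.
Proof.
move=> t01 t01' h.
have E : (t - t') * \prod_(i < k) (stage_choices m p i)%:R = radix_rem t k - radix_rem t' k.
  elim: k h => [|k IH] h; first by rewrite big_ord0 mulr1.
  rewrite big_ord_recr mulrA IH /=; last by move=> i ik; apply: h; apply: ltnW.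
  rewrite -!/(radix_digit _ k) h //; ring.
rewrite -[X in _ * X]ger0_norm; last by apply: prodr_ge0 => i _.
rewrite -normrM E; have := radix_rem_itv t k t01; have := radix_rem_itv t' k t01'.
by move=> /andP[? ?] /andP[? ?]; rewrite ler_norml; lra.
Qed.

(** The arrangement of the blocks of stage k selected by the k-th digit of t. *)
Definition stage_arrangement t k : seq nat :=
  nth [::] (permutations (stage_multiset m p k)) (radix_digit t k).

(** The word written at stage k: the selected arrangement, then 00, that is, two
    more blocks 0. *)
Definition stage_word t k : seq bool :=
  flatten (map block (stage_arrangement t k)) ++ [:: false; false].

(** The sequence of digits coded by t. *)
Definition coded_seq t : nat -> bool := concat_seq (stage_word t).

Section Point.
Variable t : R.
Hypothesis t01 : 0 <= t < 1.

Lemma perm_stage_arrangement k : perm_eq (stage_arrangement t k) (stage_multiset m p k).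
Proof. by rewrite -mem_permutations mem_nth // radix_digit_lt. Qed.

Lemma stage_word_blocks k :
  stage_word t k = flatten (map block (stage_arrangement t k ++ [:: 0%N; 0%N])).
Proof. by rewrite map_cat flatten_cat. Qed.

Lemma size_stage_word k :
  size (stage_word t k) = ((\sum_(j <- stage_multiset m p k) j.+1) + 2)%N.
Proof.
rewrite stage_word_blocks size_blocks big_cat /= (perm_big _ (perm_stage_arrangement k)).
by rewrite !big_cons big_nil.
Qed.

Lemma zeros_stage_word k :
  count negb (stage_word t k) = (size (stage_multiset m p k) + 2)%N.
Proof.
by rewrite stage_word_blocks zeros_blocks size_cat (perm_size (perm_stage_arrangement k)).
Qed.

Lemma size_stage_word_gt0 k : (0 < size (stage_word t k))%N.
Proof. by rewrite size_stage_word addn2. Qed.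

Lemma coded_seq_runs n : (0 < m)%N -> bounded_runs m m.-1 (mkseq (coded_seq t) n).
Proof.
move=> m0; have nn := leq_size_concat _ size_stage_word_gt0 n.
have : bounded_runs m m.-1 (mkseq (coded_seq t) (size (concat _ (stage_word t) n))).
  rewrite /coded_seq mkseq_concat_seq; last exact: size_stage_word_gt0.
  have -> : concat _ (stage_word t) n =
      flatten (map block (concat _ (fun k => stage_arrangement t k ++ [:: 0%N; 0%N]) n)).
    elim: n {nn} => [//|n IH]; rewrite !concatS IH map_cat flatten_cat.
    by rewrite stage_word_blocks.
  apply: bounded_runs_blocks; elim: n {nn} => [//|n IH].
  rewrite concatS !all_cat IH /= !m0 !andbT.
  by rewrite (perm_all _ (perm_stage_arrangement n)) stage_multiset_lt.
rewrite -(subnKC nn) mkseq_cat; exact: bounded_runs_catl.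
Qed.

Lemma coded_seq_zeros K z : stage_word t K = z ++ [:: false; false] ->
  let n := (size (concat _ (stage_word t) K) + size z)%N in
  ~~ coded_seq t n /\ ~~ coded_seq t n.+1.
Proof.
move=> E n; split.
  by rewrite /coded_seq;
    have [_ ->] := concat_seqE _ size_stage_word_gt0 K z false [:: false] E.
have E2 : stage_word t K = (z ++ [:: false]) ++ false :: [::] by rewrite -catA.
have [_] := concat_seqE _ size_stage_word_gt0 K _ _ _ E2.
by rewrite size_cat addnA addn1 -/n /coded_seq => ->.
Qed.

Lemma coded_seq_zeros_io n :
  exists k, ~~ coded_seq t (n + k)%N /\ ~~ coded_seq t (n + k).+1.
Proof.
have [] := coded_seq_zeros n _ erefl.
set q := (_ + _)%N => h1 h2; exists (q - n)%N.
have nq : (n <= q)%N.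
  by apply: leq_trans (leq_size_concat _ size_stage_word_gt0 n) (leq_addr _ _).
by rewrite subnKC.
Qed.

End Point.

Lemma size_concat_stage_word t t' K : 0 <= t < 1 -> 0 <= t' < 1 ->
  size (concat _ (stage_word t) K) = size (concat _ (stage_word t') K).
Proof.
by move=> t01 t01'; rewrite !size_concat; apply: eq_bigr => i _; rewrite !size_stage_word.
Qed.

Variables (beta : R).
Hypotheses (b12 : 1 < beta < 2) (m3 : (3 <= m)%N).
Hypothesis hb : word_value beta^-1 (nseq m true) = 1.

Let b0 : 0 < beta. Proof. by case/andP: b12 => b1 _; apply: lt_trans b1. Qed.
Let bi0 : 0 <= beta^-1. Proof. by rewrite invr_ge0 ltW. Qed.
Let m0 : (0 < m)%N. Proof. exact: leq_trans m3. Qed.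

(** The point coded by t. *)
Definition coded_point t : R := expansion_value beta^-1 (coded_seq t).

Lemma coded_point_greedy t : 0 <= t < 1 ->
  0 <= coded_point t < 1 /\
  forall n, digit beta n.+1 (coded_point t) = coded_seq t n.
Proof.
move=> t01; apply: (@expansion_value_greedy _ beta m) => //.
- by move=> n; apply: coded_seq_runs.
- exact: coded_seq_zeros_io.
Qed.

(** Points whose codes first differ at stage k are far apart: their expansions
    differ during this stage, and the pair of zeros that ends it creates a
    gap between them. *)
Lemma coded_point_separation t t' k : 0 <= t < 1 -> 0 <= t' < 1 ->
  (forall i, (i < k)%N -> radix_digit t i = radix_digit t' i) ->
  radix_digit t k != radix_digit t' k ->
  beta^-1 ^+ (size (concat _ (stage_word t) k.+1)).+1
    <= `|coded_point t - coded_point t'|.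
Proof.
move=> t01 t01' agree differ.
have Ck : concat _ (stage_word t) k = concat _ (stage_word t') k.
  congr flatten; apply: (@eq_from_nth _ [::]); rewrite !size_mkseq // => i ik.
  by rewrite !nth_mkseq // /stage_word /stage_arrangement agree.
pose z t := flatten (map block (stage_arrangement t k)).
have szz : size (z t) = size (z t').
  have := size_stage_word t t01 k; rewrite -(size_stage_word t' t01' k) /stage_word.
  by rewrite !size_cat => /addIn.
have zz : z t != z t'.
  apply/eqP => /flatten_block_inj /eqP; rewrite /stage_arrangement nth_uniq.
  - by apply/negP.
  - exact: radix_digit_lt.
  - exact: radix_digit_lt.
  - exact: permutations_uniq.
have [q [c [r [r' [E E' rr]]]]] := first_difference _ _ szz zz.
(* By symmetry the expansion of t has the digit 1 at the first difference. *)
wlog ct : t t' c r r' t01 t01' agree differ Ck szz zz E E' rr / c = true.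
  move=> wl; case: c E E' => E E'; first exact: (wl t t' true r r').
  rewrite distrC (size_concat_stage_word _ _ _ t01 t01').
  apply: (wl t' t true r' r) => //; [|by rewrite eq_sym|by rewrite eq_sym].
  by move=> i ik; rewrite agree.
rewrite {}ct /= in E E'.
pose n := (size (concat _ (stage_word t) k) + size q)%N.
have W1 : stage_word t k = q ++ true :: (r ++ [:: false; false]).
  by rewrite /stage_word -/(z t) E -catA.
have W2 : stage_word t' k = q ++ false :: (r' ++ [:: false; false]).
  by rewrite /stage_word -/(z t') E' -catA.
have [M1 d1] := concat_seqE _ (size_stage_word_gt0 t t01) k _ _ _ W1.
have [M2 d2] := concat_seqE _ (size_stage_word_gt0 t' t01') k _ _ _ W2.
rewrite -Ck -/n in M2 d2; rewrite -/n in M1 d1.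
have lo : word_value beta^-1 (concat _ (stage_word t) k ++ q) + beta^-1 ^+ n.+1
    <= coded_point t.
  have := le_expansion_value beta m (coded_seq t) b12 m3 hb
    (fun n => coded_seq_runs t t01 n m0) n.+1.
  rewrite mkseqS -cats1 word_value_cat size_mkseq /coded_seq M1 d1 /=.
  by rewrite addr0 mulr1 -exprSr.
have [] := coded_seq_zeros t' t01' k (q ++ false :: r').
  by rewrite W2 -catA.
rewrite -Ck size_cat /= addnA -/n addnS -addSn => z1 z2.
have hi := expansion_value_gap beta m (coded_seq t') b12 m3 hb
  (fun n => coded_seq_runs t' t01' n m0) n.+1 (size r') z1 z2.
move: hi; rewrite mkseqS -cats1 word_value_cat size_mkseq [X in mkseq X]/coded_seq M2.
rewrite [coded_seq t' n]d2 /= !(addr0, mulr0).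
rewrite mulrBr mulr1 -exprD => hi.
have -> : (size (concat _ (stage_word t) k.+1)).+1 = (n.+1 + (size r' + 3))%N.
  rewrite concatS W1 !size_cat /= size_cat /= rr /n; clear; lia.
by apply: le_trans (ler_norm _); rewrite -/(coded_point t') in hi; lra.
Qed.

End Construction.

(** * Frequencies and lengths of the coded points *)

Section Lengths.
Context {R : realType}.
Variables (m : nat) (a : R) (p : nat -> R).
Hypotheses (a0 : 0 < a) (a1 : a <= 1).
Hypothesis p0 : forall j, (j < m)%N -> 0 <= p j.
Hypothesis pa : \sum_(j < m) p j = a.
Hypothesis p1 : \sum_(j < m) (j.+1)%:R * p j = 1.
Variable t : R.
Hypothesis t01 : 0 <= t < 1.

Lemma truncn_stage k (j : 'I_m) :
  (Num.truncn (k%:R * p j))%:R <= k%:R * p j < (Num.truncn (k%:R * p j))%:R + 1.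
Proof. by rewrite natr1; apply: truncn_itv; rewrite mulr_ge0 // p0. Qed.

Lemma size_stage_wordE k : (size (stage_word m p t k))%:R =
  \sum_(j < m) (Num.truncn (k%:R * p j))%:R * (j.+1)%:R + 2 :> R.
Proof. by rewrite size_stage_word // natrD natr_sum big_stage_multiset. Qed.

Lemma natr_blocksE (k : nat) : k%:R = \sum_(j < m) k%:R * (j.+1%:R * p j).
Proof. by rewrite -mulr_sumr p1 mulr1. Qed.

Lemma size_stage_word_le k : (size (stage_word m p t k))%:R <= k%:R + 2 :> R.
Proof.
rewrite size_stage_wordE lerD2r [leRHS]natr_blocksE.
apply: ler_sum => j _; rewrite mulrCA mulrC ler_wpM2l //.
by case/andP: (truncn_stage k j).
Qed.

Lemma size_stage_word_ge k :
  k%:R - \sum_(j < m) (j.+1)%:R <= (size (stage_word m p t k))%:R :> R.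
Proof.
rewrite size_stage_wordE [X in X - _]natr_blocksE -sumrB.
apply: (@le_trans _ _ (\sum_(j < m) (Num.truncn (k%:R * p j))%:R * j.+1%:R)); last lra.
apply: ler_sum => j _; have /andP[_ h] := truncn_stage k j.
rewrite [_ * (_ * _)](_ : _ = (k%:R * p j) * j.+1%:R); last by ring.
have j0 : 0 <= j.+1%:R :> R by [].
by rewrite -[X in _ - X]mul1r -mulrBl ler_wpM2r // lerBlDr ltW.
Qed.

(** A bound, independent of the stage, for the difference between the number of
    zeros of a stage and a times its length. *)
Definition zero_discrepancy : R := \sum_(j < m) `|1 - a * (j.+1)%:R| + 2.

Lemma zeros_stage_word_dev k :
  `|(count negb (stage_word m p t k))%:R - a * (size (stage_word m p t k))%:R|
    <= zero_discrepancy.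
Proof.
rewrite zeros_stage_word // size_stage_wordE natrD size_stage_multiset.
have -> : \sum_(j < m) (Num.truncn (k%:R * p j))%:R + 2%:R
     - a * (\sum_(j < m) (Num.truncn (k%:R * p j))%:R * j.+1%:R + 2)
   = \sum_(j < m) ((Num.truncn (k%:R * p j))%:R - k%:R * p j) * (1 - a * j.+1%:R)
     + 2 * (1 - a) :> R.
  have -> : \sum_(j < m) ((Num.truncn (k%:R * p j))%:R - k%:R * p j) * (1 - a * j.+1%:R)
    = \sum_(j < m) (Num.truncn (k%:R * p j))%:R
      - a * (\sum_(j < m) (Num.truncn (k%:R * p j))%:R * j.+1%:R)
      - k%:R * (\sum_(j < m) p j) + k%:R * a * (\sum_(j < m) j.+1%:R * p j).
    rewrite !mulr_sumr -!sumrB -big_split /=.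
    by apply: eq_bigr => j _; ring.
  by rewrite pa p1; ring.
apply: le_trans (ler_normD _ _) _; apply: lerD.
  apply: le_trans (ler_norm_sum _ _ _) _; apply: ler_sum => j _.
  rewrite normrM ler_piMl //; have := truncn_stage k j.
  by rewrite ler_norml; lra.
by rewrite ler_norml; apply/andP; split; [have := a1; lra|have := a0; lra].
Qed.

Let S K : nat := size (concat _ (stage_word m p t) K).

(** With the next lemma, the total length of the first K stages is
    K^2 / 2 + O(K), so a single stage is negligible. *)
Lemma size_concat_le K : (S K.+1)%:R <= K%:R * (K%:R + 1) / 2 + 2 * (K%:R + 1) :> R.
Proof.
rewrite /S; elim: K => [|K IH].
  rewrite concatS size_cat natrD; have := size_stage_word_le 0.
  by rewrite mulr0n /=; lra.
rewrite concatS size_cat natrD; have := size_stage_word_le K.+1.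
by move: IH; rewrite -(natr1 K); lra.
Qed.

Lemma size_concat_ge K :
  K%:R * (K%:R - 1) / 2 - (\sum_(j < m) (j.+1)%:R) * K%:R <= (S K)%:R :> R.
Proof.
rewrite /S; elim: K => [|K IH]; first by rewrite !mul0r mulr0 subrr.
rewrite concatS size_cat natrD; have := size_stage_word_ge K.
move: IH; rewrite -(natr1 K); set c := \sum_(j < m) _; lra.
Qed.

Lemma zeros_concat_dev K :
  `|(count negb (concat _ (stage_word m p t) K))%:R - a * (S K)%:R|
    <= zero_discrepancy * K%:R.
Proof.
rewrite /S; elim: K => [|K IH]; first by rewrite /= !mulr0 subrr normr0.
rewrite concatS size_cat count_cat !natrD -(natr1 K) [zero_discrepancy * _]mulrDr mulr1.
rewrite [_ - _](_ : _ = ((count negb (concat _ (stage_word m p t) K))%:R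
    - a * (size (concat _ (stage_word m p t) K))%:R) +
   ((count negb (stage_word m p t K))%:R - a * (size (stage_word m p t K))%:R)); last by ring.
by apply: le_trans (ler_normD _ _) _; rewrite lerD // zeros_stage_word_dev.
Qed.

Lemma stage_exists n : exists K, (S K <= n < S K.+1)%N.
Proof.
have ex : exists K, (S K <= n)%N by exists 0%N.
have ub K : (S K <= n)%N -> (K <= n)%N.
  by apply: leq_trans; apply: leq_size_concat => k; apply: size_stage_word_gt0.
case: (ex_maxnP ex ub) => K h1 h2; exists K; rewrite h1 /= ltnNge.
by apply/negP => /h2; rewrite ltnn.
Qed.

Lemma leq_concat K L : (K <= L)%N -> (S K <= S L)%N.
Proof.
move=> /subnKC <-; rewrite /S.
by have [v ->] := concatD _ (stage_word m p t) K (L - K); rewrite size_cat leq_addr.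
Qed.

Lemma coded_seq_zeros_dev n K : (S K <= n < S K.+1)%N ->
  `|(count negb (mkseq (coded_seq m p t) n))%:R - a * n%:R|
    <= zero_discrepancy * K%:R + (K%:R + 2).
Proof.
move=> /andP[h1 h2]; rewrite -(subnKC h1) mkseq_cat count_cat.
rewrite /coded_seq mkseq_concat_seq; last by move=> k; apply: size_stage_word_gt0.
set v := mkseq _ _; rewrite !natrD mulrDr.
rewrite [_ - _](_ : _ = ((count negb (concat _ (stage_word m p t) K))%:R - a * (S K)%:R)
  + ((count negb v)%:R - a * (n - S K)%:R)); last by rewrite /S; ring.
apply: le_trans (ler_normD _ _) _; apply: lerD; first exact: zeros_concat_dev.
have sv : size v = (n - S K)%N by rewrite size_mkseq.
have l1 : (n - S K)%:R <= K%:R + 2 :> R.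
  apply: le_trans (size_stage_word_le K); rewrite ler_nat.
  by move: h2; rewrite /S concatS size_cat; lia.
have l2 : (count negb v)%:R <= (n - S K)%:R :> R by rewrite ler_nat -sv count_size.
have l3 : 0 <= (count negb v)%:R :> R by [].
have l4 : 0 <= (n - S K)%:R :> R by [].
have l5 : 0 <= a * (n - S K)%:R by rewrite mulr_ge0 // ltW.
have l6 : a * (n - S K)%:R <= (n - S K)%:R by rewrite ler_piMl.
by rewrite ler_norml; lra.
Qed.

Lemma zero_discrepancy_ge0 : 0 <= zero_discrepancy.
Proof. by rewrite addr_ge0 // sumr_ge0. Qed.

Lemma coded_seq_frequency :
  (fun n => (count negb (mkseq (coded_seq m p t) n))%:R / n%:R : R) @ \oo --> a.
Proof.
apply/cvgrPdist_le => e e0.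
pose c := \sum_(j < m) (j.+1)%:R : R.
have c0 : 0 <= c by apply: sumr_ge0.
have d0 := zero_discrepancy_ge0.
(* From K = B on, e times the length of the first K stages exceeds the linear
   bound on the discrepancy. *)
pose B := 2 * (zero_discrepancy + 3) / e + 2 * c + 1.
pose K0 := (Num.truncn B).+1.
have K0B : B <= K0%:R by apply: ltW; apply: truncnS_gt.
exists (S K0).+1 => //= n nS.
have n0 : 0 < n%:R :> R by rewrite ltr0n; apply: leq_trans nS.
have [K hK] := stage_exists n.
have KK : (K0 <= K)%N.
  rewrite leqNgt; apply/negP => /leq_concat h; case/andP: hK => _ hK.
  by have := ltn_trans (leq_trans hK h) nS; rewrite ltnn.
have {}K0B : B <= K%:R by rewrite (le_trans K0B) // ler_nat.
have K1 : 1 <= K%:R :> R by rewrite ler1n; apply: leq_trans KK.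
have H1 := coded_seq_zeros_dev n K hK.
rewrite distrC; set Z := (count _ _)%:R in H1 *.
rewrite [_ - a](_ : _ = (Z - a * n%:R) / n%:R); last first.
  by field; rewrite gt_eqF.
rewrite normrM [`|n%:R^-1|]gtr0_norm ?invr_gt0 // ler_pdivrMr //.
apply: le_trans H1 _.
have H2 : e * (S K)%:R <= e * n%:R.
  by rewrite ler_pM2l // ler_nat; case/andP: hK.
apply: le_trans H2; have H3 := size_concat_ge K; rewrite -/c in H3.
have H4 : e * (K%:R * (K%:R - 1) / 2 - c * K%:R) <= e * (S K)%:R by rewrite ler_pM2l.
apply: le_trans H4.
have H5 : 2 * (zero_discrepancy + 3) <= e * (K%:R - 1 - 2 * c).
  rewrite [leRHS]mulrC -ler_pdivrMr //; move: K0B; rewrite /B.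
  by move: (2 * (_ + 3) / e) => q; lra.
have K00 : 0 <= K%:R :> R by [].
have H6 : K%:R * (2 * (zero_discrepancy + 3)) <= K%:R * (e * (K%:R - 1 - 2 * c)).
  exact: ler_wpM2l.
move: H6 K1; move: (zero_discrepancy) (K%:R) => z k; nra.
Qed.

(** The growth of the number of codes compared with the length of the
    expansions, including the next stage. *)
Lemma stage_growth h : 0 <= h < block_entropy m a p ->
  exists D, forall k, h * ((S k.+1).+1)%:R - D
    <= \sum_(i < k) ln ((stage_choices m p i)%:R).
Proof.
move=> /andP[h0 hH].
pose h' := (h + block_entropy m a p) / 2.
have hh : h < h' by rewrite /h'; lra.
have h'H : h' < block_entropy m a p by rewrite /h'; lra.
have [D0 HD] := ln_stage_choices_linear _ _ _ a0 a1 p0 pa _ h'H.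
have {}HD k : h' * (k%:R * (k%:R - 1) / 2) - D0 * k%:R
    <= \sum_(i < k) ln ((stage_choices m p i)%:R : R).
  elim: k => [|k IH]; first by rewrite big_ord0 !mul0r !mulr0 subrr.
  rewrite big_ord_recr /=; have := HD k; move: IH.
  by rewrite -(natr1 k); move: (\sum_(i < k) _) => s; lra.
(* The difference of the two sides is bounded below by a quadratic polynomial
   in k, with leading coefficient q > 0; D comes from completing the square. *)
pose q := (h' - h) / 2; pose l := h' / 2 + D0 + 5 / 2 * h.
have q0 : 0 < q by rewrite /q; lra.
exists (l ^+ 2 / (4 * q) + 3 * h) => k.
apply: le_trans (HD k).
have := size_concat_le k; rewrite -(natr1 (S _)) => hS.
have {}hS : h * (S k.+1)%:R <= h * (k%:R * (k%:R + 1) / 2 + 2 * (k%:R + 1)).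
  exact: ler_wpM2l.
have sq : 0 <= q * (k%:R - l / (2 * q)) ^+ 2 by apply: mulr_ge0; [exact: ltW|exact: sqr_ge0].
have E : q * (k%:R - l / (2 * q)) ^+ 2 = q * k%:R ^+ 2 - l * k%:R + l ^+ 2 / (4 * q).
  by field; rewrite gt_eqF.
rewrite E in sq; move: hS sq.
move: (l ^+ 2 / _) (S k.+1)%:R => w s.
have -> : q * k%:R ^+ 2 - l * k%:R = 
  (h' * (k%:R * (k%:R - 1) / 2) - D0 * k%:R) -
  (h * (k%:R * (k%:R + 1) / 2 + 2 * (k%:R + 1))) + 2 * h.
  by rewrite /q /l; field.
lra.
Qed.

End Lengths.

(** * Lower bound *)

Section Lower.
Context {R : realType}.

Lemma cover_unit_interval (A : nat -> set R) (D : nat -> R) :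
  (forall i, 0 <= D i) ->
  `[0, 1[%classic `<=` \bigcup_i A i ->
  (forall i t t', A i t -> A i t' -> `|t - t'| <= D i) ->
  (1 <= \sum_(0 <= i <oo) (2 * D i)%:E)%E.
Proof.
move=> D0 cov hA.
pose I i : set R := if pselect (exists t, A i t) is left e then
   `[sval (cid e) - D i, sval (cid e) + D i]%classic else set0.
have mI i : measurable (I i).
  by rewrite /I; case: pselect => [e|_]; [exact: measurable_itv|exact: measurable0].
have AI i : A i `<=` I i.
  move=> t At; rewrite /I; case: pselect => [e|[]]; last by exists t.
  have := hA i _ _ At (svalP (cid e)); rewrite /= in_itv /= ler_norml.
  by move=> /andP[h1 h2]; apply/andP; split; lra.
have lI i : (lebesgue_measure (I i) <= (2 * D i)%:E)%E.
  rewrite /I; case: pselect => [e|_]; last first.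
    by rewrite measure0 lee_fin mulr_ge0.
  rewrite lebesgue_measure_itv /=; case: ifP => _.
    by rewrite -EFinB lee_fin; lra.
  by rewrite lee_fin mulr_ge0.
have l1 : lebesgue_measure (`[0, 1[%classic : set R) = 1%E.
  by rewrite lebesgue_measure_itv /= lte_fin ltr01 sube0.
rewrite -l1.
apply: (@le_trans _ _ (\sum_(0 <= i <oo) lebesgue_measure (I i))%E).
  apply: measure_sigma_subadditive => //.
  by move=> t /cov[i _ At]; exists i => //; apply: AI.
by apply: lee_nneseries.
Qed.

(** If f maps the unit interval into E and its inverse is s-Hölder, then the
    s-dimensional Hausdorff measure of E is positive. *)
Lemma hausdorff_measure_holder (E : set R) (f : R -> R) (s C : R) :
  0 <= s -> 0 < C ->
  (forall t, 0 <= t < 1 -> E (f t)) ->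
  (forall t t', 0 <= t < 1 -> 0 <= t' < 1 -> t != t' ->
     `|t - t'| <= C * `|f t - f t'| `^ s) ->
  hausdorff_measure s E != 0%E.
Proof.
move=> s0 C0 fE hf; rewrite gt_eqF //.
suff h : (((2 * C)^-1)%:E <= hausdorff_pre s 1 E)%E.
  apply: (@lt_le_trans _ _ ((2 * C)^-1)%:E).
    by rewrite lte_fin invr_gt0 mulr_gt0.
  by apply: le_trans h _; apply: ereal_sup_ubound; exists 1 => /=.
apply: le_ereal_inf_tmp => _ [U [cov hd] <-].
have dfin i : (diam_pow s (U i)) \is a fin_num.
  rewrite ge0_fin_numE ?diam_pow_ge0 //.
  by apply: le_lt_trans (diam_pow_le _ _ _ s0 (hd i)) _; rewrite ltry.
pose D i := C * fine (diam_pow s (U i)).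
pose A i := [set t | 0 <= t < 1 /\ U i (f t)].
have D0 i : 0 <= D i by apply: mulr_ge0; [exact: ltW|apply: fine_ge0; exact: diam_pow_ge0].
have := cover_unit_interval A D D0.
rewrite (_ : (\sum_(0 <= i <oo) (2 * D i)%:E)%E =
   ((2 * C)%:E * \sum_(0 <= i <oo) diam_pow s (U i))%E); last first.
  rewrite -nneseriesZl; last by move=> i _; apply: diam_pow_ge0.
  by apply: eq_eseriesr => i _; rewrite /D mulrA EFinM fineK.
move=> h; rewrite -[leRHS]mul1e -[X in (X * _)%E](_ :
    ((2 * C)^-1)%:E * (2 * C)%:E = 1%E)%E; last first.
  by rewrite -EFinM mulVf // gt_eqF // mulr_gt0.
rewrite -muleA -[leLHS]mule1 lee_pmul2l //; last first.
  by rewrite lte_fin invr_gt0 mulr_gt0.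
apply: h.
  move=> t; rewrite /= in_itv /= => t01; have [i _ hi] := cov _ (fE t t01).
  by exists i.
move=> i t t' [t01 Ut] [t01' Ut']; have [->|tt] := eqVneq t t'.
  by rewrite subrr normr0.
apply: le_trans (hf t t' t01 t01' tt) _; rewrite ler_pM2l //.
rewrite -lee_fin fineK // /diam_pow ifF; last first.
  by apply/negbTE/set0P; exists (f t).
rewrite -poweR_EFin.
have dle : (`|f t - f t'|%:E <= diam (U i))%E.
  by apply: ereal_sup_ubound; exists (f t, f t').
have d0 : (0 <= diam (U i))%E by apply: diam_ge0; exists (f t).
by apply: gt0_ler_poweR; rewrite // in_itv /= ?leey ?andbT ?lee_fin.
Qed.

Lemma hausdorff_measure_freq_set_neq0 beta m a (p : nat -> R) s :
  1 < beta < 2 -> (3 <= m)%N -> word_value beta^-1 (nseq m true) = 1 ->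
  0 < a -> a <= 1 -> (forall j, (j < m)%N -> 0 <= p j) ->
  \sum_(j < m) p j = a -> \sum_(j < m) j.+1%:R * p j = 1 ->
  0 <= s -> s * ln beta < block_entropy m a p ->
  hausdorff_measure s (freq_set beta a) != 0%E.
Proof.
move=> b12 m3 hb a0 a1 p0 pa p1 s0 hs.
have /andP[b1 b2] := b12; have b0 : 0 < beta by apply: lt_trans b1.
have lb : 0 < ln beta by apply: ln_gt0.
(* An exponent h larger than s ln beta, hence positive even when s = 0. *)
pose h := (s * ln beta + block_entropy m a p) / 2.
have sl0 : 0 <= s * ln beta by rewrite mulr_ge0 // ltW.
have h0 : 0 < h by rewrite /h; lra.
have sh : s * ln beta <= h by rewrite /h; lra.
have hH : h < block_entropy m a p by rewrite /h; lra.
pose S t K := size (concat _ (stage_word m p t) K).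
have t00 : 0 <= (0 : R) < 1 by rewrite lexx ltr01.
have h01 : 0 <= h < block_entropy m a p by rewrite (ltW h0).
have [D HD] := stage_growth m a p a0 a1 p0 pa p1 0 t00 h h01.
have SE t K : 0 <= t < 1 -> S t K = S 0 K.
  by move=> t01; apply: size_concat_stage_word.
have agree_dist t t' k : 0 <= t < 1 -> 0 <= t' < 1 ->
    (forall i, (i < k)%N -> radix_digit m p t i = radix_digit m p t' i) ->
    `|t - t'| <= expR (D - h * (S 0 k.+1).+1%:R).
  move=> t01 t01' /(radix_dist _ _ _ _ _ t01 t01').
  have P0 : 0 < \prod_(i < k) (stage_choices m p i)%:R :> R.
    by apply: prodr_gt0 => i _; rewrite ltr0n stage_choices_gt0.
  rewrite -ler_pdivlMr // mul1r => /le_trans; apply.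
  rewrite -[X in X^-1]lnK ?posrE // -expRN ler_expR.
  have -> : ln (\prod_(i < k) (stage_choices m p i)%:R) =
      \sum_(i < k) ln (stage_choices m p i)%:R :> R.
    elim: (k) => [|j IH]; first by rewrite !big_ord0 ln1.
    rewrite !big_ord_recr lnM ?posrE ?IH ?ltr0n ?stage_choices_gt0 //.
    by apply: prodr_gt0 => i _; rewrite ltr0n stage_choices_gt0.
  by have := HD k; rewrite -/(S 0 k.+1); lra.
apply: (hausdorff_measure_holder _ (coded_point m p beta) s (expR D)) => //.
- exact: expR_gt0.
- move=> t t01; have [x01 hd] := coded_point_greedy m p beta b12 m3 hb t t01.
  split=> //; set x := coded_point _ _ _ _ in x01 hd *.
  have -> : (fun n => (num_zero_digits beta n x)%:R / n%:R : R) =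
      (fun n => (count negb (mkseq (coded_seq m p t) n))%:R / n%:R : R).
    apply/funext => n; rewrite num_zero_digitsE //; congr (_%:R / _).
    by congr count; apply: eq_mkseq => k; rewrite hd; case: (coded_seq _ _ _ _).
  exact: coded_seq_frequency.
- move=> t t' t01 t01' tt.
  have ex : exists k, radix_digit m p t k != radix_digit m p t' k.
    apply/not_existsP => hn.
    have same k : radix_digit m p t k = radix_digit m p t' k.
      by apply/eqP; apply/negPn/negP => /hn.
    have r01 : 0 <= expR (- h) < 1 by rewrite expR_ge0 expR_lt1; lra.
    have e0 : 0 < `|t - t'| / expR D.
      by rewrite divr_gt0 ?expR_gt0 // normr_gt0 subr_eq0.
    have [N /(_ N (leqnn N))] := expr_small _ _ r01 e0.
    rewrite ltr_pdivlMr ?expR_gt0 // ltNge => /negP; apply.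
    apply: le_trans (agree_dist t t' N t01 t01' (fun i _ => same i)) _.
    rewrite -expRM_natl -expRD ler_expR.
    have : N%:R <= (S 0 N.+1).+1%:R :> R.
      rewrite ler_nat ltnW // ltnS /S ltnW // leq_size_concat // => k.
      exact: size_stage_word_gt0.
    by rewrite -(ler_pM2l h0); lra.
  case: (ex_minnP ex) => k hk hmin.
  have agree i : (i < k)%N -> radix_digit m p t i = radix_digit m p t' i.
    by move=> ik; apply/eqP; apply: contraTT ik => /hmin; rewrite -leqNgt.
  apply: le_trans (agree_dist t t' k t01 t01' agree) _.
  have := coded_point_separation m p beta b12 m3 hb t t' k t01 t01' agree hk.
  rewrite -/(S t k.+1) SE //; set n := (S 0 k.+1).+1 => hsep.
  rewrite expRD ler_pM2l ?expR_gt0 //.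
  apply: (@le_trans _ _ ((beta^-1 ^+ n) `^ s)); last first.
    by apply: ge0_ler_powR; rewrite // nnegrE ?exprn_ge0 ?invr_ge0 ?ltW.
  have -> : beta^-1 ^+ n = expR (- (n%:R * ln beta)).
    by rewrite expRN expRM_natl lnK ?exprVn.
  rewrite -expRM ler_expR -[X in _ <= X]opprK lerN2.
  have n0 : 0 <= n%:R :> R by [].
  by have := ler_wpM2l n0 sh; lra.
Qed.

End Lower.

(** * Maximal entropy of block laws *)

Section Optimum.
Context {R : realType}.
Implicit Types (m : nat) (a t : R) (p : nat -> R).

(** Frequencies p j of the blocks 0 1^j in a sequence where 0 has frequency a:
    each block contains one zero and has length j + 1. *)
Definition block_law m a p : Prop :=
  [/\ forall j, (j < m)%N -> 0 <= p j, \sum_(j < m) p j = a &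
      \sum_(j < m) j.+1%:R * p j = 1].

Lemma block_law_le m a p j : block_law m a p -> (j < m)%N -> p j <= a.
Proof. by case=> p0 pa _; apply: le_total_freq. Qed.

Lemma block_entropy_ge0 m a p : block_law m a p -> 0 <= block_entropy m a p.
Proof.
move=> hp; apply: sumr_ge0 => j _; have jm := ltn_ord j.
have pa := block_law_le _ _ _ _ hp jm; case: hp => p0 _ _.
have := p0 _ jm; rewrite le_eqVlt => /predU1P[<-|pj]; first by rewrite mul0r.
by rewrite mulr_ge0 ?(ltW pj) // ln_ge0 // ler_pdivlMr // mul1r.
Qed.

Lemma block_law_mean m a p : block_law m a p -> \sum_(j < m) j%:R * p j = 1 - a.
Proof.
case=> _ pa p1; rewrite -[RHS](_ : \sum_(j < m) j.+1%:R * p j - \sum_(j < m) p j = _).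
  by rewrite -sumrB; apply: eq_bigr => j _; rewrite -natr1; ring.
by rewrite pa p1.
Qed.

Lemma pressureE m a t p : block_law m a p ->
  pressure m a t = \sum_(j < m) p j * (ln (partition_sum m t) - j%:R * ln t).
Proof.
move=> hp; rewrite /pressure -(block_law_mean _ _ _ hp); case: hp => _ <- _.
rewrite !mulr_suml -sumrB; apply: eq_bigr => j _; ring.
Qed.

(** The Gibbs inequality, termwise from ln y <= y - 1. *)
Lemma block_entropy_le_pressure m a t p : (0 < m)%N -> 0 < a -> 0 < t ->
  block_law m a p -> block_entropy m a p <= pressure m a t.
Proof.
move=> m0 a0 t0 hp; rewrite (pressureE _ _ _ _ hp) -subr_le0 -sumrB.
have Z0 : 0 < partition_sum m t.
  by apply: lt_le_trans (partition_sum_ge1 _ _ m0 (ltW t0)).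
apply: (@le_trans _ _ (\sum_(j < m) (a / partition_sum m t * t ^+ j - p j))); last first.
  rewrite sumrB -mulr_sumr; case: hp => _ -> _.
  by rewrite -/(partition_sum m t) divfK ?gt_eqF // subrr.
apply: ler_sum => j _; case: hp => p0 _ _; have := p0 _ (ltn_ord j).
have q0 : 0 < a / partition_sum m t * t ^+ j.
  by rewrite mulr_gt0 ?exprn_gt0 // divr_gt0.
rewrite le_eqVlt => /predU1P[<-|pj]; first by rewrite !mul0r !subr0 ltW.
rewrite -mulrBr; set q := a / _ * _ in q0 *.
have -> : ln (a / p j) - (ln (partition_sum m t) - j%:R * ln t) = ln (q / p j).
  rewrite !ln_div ?posrE // /q lnM ?posrE ?divr_gt0 ?exprn_gt0 //.
  by rewrite ln_div ?posrE // lnXn // -mulr_natl; ring.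
have h : ln (q / p j) <= q / p j - 1.
  have := @le_ln1Dx R (q / p j - 1); rewrite addrCA subrr addr0; apply.
  by rewrite ltrBDr addNr divr_gt0.
have := ler_wpM2l (ltW pj) h.
by rewrite mulrBr mulr1 [_ * (q / _)]mulrC divfK ?gt_eqF.
Qed.

Lemma gibbs_block_entropy m a t : (0 < m)%N -> 0 < a -> 0 < t ->
  block_law m a (fun j => a / partition_sum m t * t ^+ j) ->
  pressure m a t = block_entropy m a (fun j => a / partition_sum m t * t ^+ j).
Proof.
move=> m0 a0 t0 hp; rewrite (pressureE _ _ _ _ hp).
have Z0 : 0 < partition_sum m t.
  by apply: lt_le_trans (partition_sum_ge1 _ _ m0 (ltW t0)).
apply: eq_bigr => j _; congr (_ * _).
have -> : a / (a / partition_sum m t * t ^+ j) = partition_sum m t / t ^+ j.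
  by field; rewrite !gt_eqF ?exprn_gt0.
by rewrite ln_div ?posrE ?exprn_gt0 // lnXn // mulr_natl.
Qed.

(** The parameter for which the frequencies a t^j / Z have mean block length
    1 / a. *)
Lemma gibbs_parameter m a : (0 < m)%N -> m%:R^-1 < a -> a < 1 ->
  exists2 t, 0 < t & \sum_(j < m) (a * j.+1%:R - 1) * t ^+ j = 0.
Proof.
move=> m0 am a1.
(* In the variable x = t / (1 + t), and up to a power of 1 - x, the left-hand
   side is a polynomial with opposite signs at 0 and 1. *)
pose P : {poly R} :=
  \sum_(j < m) (a * j.+1%:R - 1)%:P * 'X^j * (1 - 'X) ^+ (m.-1 - j).
have PE x : P.[x] = \sum_(j < m) (a * j.+1%:R - 1) * x ^+ j * (1 - x) ^+ (m.-1 - j).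
  by rewrite horner_sum; apply: eq_bigr => j _; rewrite !hornerE.
have P0 : P.[0] = a - 1.
  rewrite PE; case: (m) m0 => [//|n] _; rewrite big_ord_recl big1.
    by rewrite addr0 expr0 subr0 expr1n !mulr1.
  by move=> i _; rewrite expr0n /= mulr0 mul0r.
have P1 : P.[1] = a * m%:R - 1.
  rewrite PE; case: (m) m0 => [//|n] _; rewrite big_ord_recr big1 /=.
    by rewrite add0r subnn expr0 expr1n !mulr1.
  by move=> i _; rewrite subrr expr0n subn_eq0 leqNgt ltn_ord /= mulr0.
have am1 : 0 < a * m%:R - 1.
  by rewrite subr_gt0 -ltr_pdivrMr ?ltr0n // mul1r.
have [x /andP[x0 x1] /rootP Px] : exists2 x, 0 <= x <= 1 & root P x.
  by apply: poly_ivt; rewrite // P0 P1; apply/andP; split; lra.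
have {}x0 : 0 < x.
  by rewrite lt_neqAle x0 andbT; apply/eqP => e; move: Px; rewrite -e P0; lra.
have {}x1 : x < 1.
  by rewrite lt_neqAle x1 andbT; apply/eqP => e; move: Px; rewrite e P1; lra.
have y0 : 0 < 1 - x by lra.
exists (x / (1 - x)); first by rewrite divr_gt0.
apply: (@mulIf _ ((1 - x) ^+ m.-1)); first by rewrite expf_neq0 // gt_eqF.
rewrite mul0r -[RHS]Px PE mulr_suml; apply: eq_bigr => j _.
rewrite -[in LHS](@subnK j m.-1) ?exprD; last by rewrite -ltnS prednK.
by rewrite expr_div_n; field; rewrite expf_neq0 // gt_eqF.
Qed.

(** For a = 1 the pressure tends to 0 as t tends to 0. *)
Lemma pressure_inf_one m (e : R) : (0 < m)%N -> 0 < e ->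
  exists2 t, 0 < t & pressure m 1 t <= e.
Proof.
move=> m0 e0; have mR : 0 < m%:R :> R by rewrite ltr0n.
have me : 0 < m%:R + e by lra.
exists (e / (m%:R + e)); first by rewrite divr_gt0.
set t := e / _; have t0 : 0 < t by rewrite divr_gt0.
have t1 : t <= 1 by rewrite ler_pdivrMr // mul1r; lra.
have mt : m%:R * t <= e.
  by rewrite /t mulrA ler_pdivrMr // mulrC ler_pM2l //; lra.
rewrite /pressure subrr mul0r subr0 mul1r; apply: le_trans mt.
have : partition_sum m t <= 1 + m%:R * t.
  rewrite /partition_sum; case: (m) m0 => [//|n] _.
  rewrite big_ord_recl expr0 lerD2l.
  apply: (@le_trans _ _ (\sum_(i < n) t)).
    by apply: ler_sum => i _; rewrite /= exprS ler_piMr ?(ltW t0) // exprn_ile1 // ltW.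
  by rewrite sumr_const card_ord -[t *+ n]mulr_natl ler_wpM2r ?(ltW t0) // ler_nat.
have Z0 : 0 < partition_sum m t.
  by apply: lt_le_trans (partition_sum_ge1 _ _ m0 (ltW t0)).
have mt0 : 0 < m%:R * t by rewrite mulr_gt0.
move=> h; apply: le_trans (_ : ln (1 + m%:R * t) <= _).
  by rewrite ler_ln ?posrE //; lra.
by apply: le_ln1Dx; lra.
Qed.

(** For a = 1 / m the pressure tends to 0 as t tends to infinity. *)
Lemma pressure_inf_min m (e : R) : (1 < m)%N -> 0 < e ->
  exists2 t, 0 < t & pressure m m%:R^-1 t <= e.
Proof.
move=> m1 e0; have m0 : (0 < m)%N by apply: ltnW.
have mR : 0 < m%:R :> R by rewrite ltr0n.
have e1 : 0 < e^-1 by rewrite invr_gt0.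
exists (1 + e^-1); first by lra.
set t := 1 + _; have t0 : 0 < t by rewrite /t; lra.
have t1 : 1 <= t by rewrite /t; lra.
have te : t^-1 <= e by rewrite invf_ple ?posrE // /t; lra.
have Z0 : 0 < partition_sum m t.
  by apply: lt_le_trans (partition_sum_ge1 _ _ m0 (ltW t0)).
have tm : 0 < t ^+ m.-1 by rewrite exprn_gt0.
have mt0 : 0 < m%:R / t by rewrite divr_gt0.
have hZ : partition_sum m t / t ^+ m.-1 <= 1 + m%:R / t.
  rewrite ler_pdivrMr // mulrDl mul1r /partition_sum.
  case: (m) m1 => [//|[//|n]] _ /=.
  rewrite big_ord_recr /= addrC lerD2l.
  apply: (@le_trans _ _ (\sum_(i < n.+1) t ^+ n)).
    by apply: ler_sum => i _; rewrite ler_weXn2l // -ltnS.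
  rewrite sumr_const card_ord -[_ *+ n.+1]mulr_natl exprS mulrA divfK ?gt_eqF //.
  by rewrite ler_pM2r ?exprn_gt0 // ler_nat.
have : ln (partition_sum m t / t ^+ m.-1) <= m%:R / t.
  apply: le_trans (_ : ln (1 + m%:R / t) <= _).
    by rewrite ler_ln ?posrE ?divr_gt0 //; lra.
  by apply: le_ln1Dx; lra.
rewrite ln_div ?posrE // lnXn // -[_ *+ m.-1]mulr_natl => h.
rewrite /pressure; apply: le_trans te.
have -> : m%:R^-1 * ln (partition_sum m t) - (1 - m%:R^-1) * ln t
   = m%:R^-1 * (ln (partition_sum m t) - m.-1%:R * ln t).
  have -> : m.-1%:R = m%:R - 1 :> R by rewrite -[in RHS](prednK m0) -natr1 addrK.
  by field; rewrite gt_eqF.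
by rewrite ler_pdivrMl.
Qed.

(** A law of maximal entropy.  Its optimality is expressed through the pressure,
    which bounds both the entropy of the other laws and the dimension. *)
Lemma optimal_block_law m a : (1 < m)%N -> m%:R^-1 <= a <= 1 ->
  exists2 p, block_law m a p &
    forall e, 0 < e -> exists2 t, 0 < t & pressure m a t <= block_entropy m a p + e.
Proof.
move=> m1 /andP[]; have m0 : (0 < m)%N by apply: ltnW.
have mR : 0 < m%:R :> R by rewrite ltr0n.
rewrite le_eqVlt => /predU1P[<- _|am].
  exists (fun j => if j == m.-1 then m%:R^-1 else 0).
    split=> [j _||]; first by case: ifP => // _; rewrite invr_ge0.
    - case: (m) m0 => [//|n] _; rewrite big_ord_recr big1 /=; first by rewrite eqxx add0r.
      by move=> i _; rewrite ltn_eqF.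
    - case: (m) m0 => [//|n] _; rewrite big_ord_recr big1 /=.
        by rewrite eqxx add0r mulfV // pnatr_eq0.
      by move=> i _; rewrite ltn_eqF // mulr0.
  move=> e e0; have [t t0 h] := pressure_inf_min m e m1 e0; exists t => //.
  rewrite (_ : block_entropy _ _ _ = 0) ?add0r //; apply: big1 => j _.
  by case: ifP => _; rewrite ?mul0r // divff ?invr_eq0 ?gt_eqF // ln1 mulr0.
rewrite le_eqVlt => /predU1P[->|a1].
  exists (fun j => if j == 0%N then 1 else 0).
    split=> [j _||]; first by case: ifP.
    - by case: (m) m0 => [//|n] _; rewrite big_ord_recl big1 // addr0.
    - by case: (m) m0 => [//|n] _; rewrite big_ord_recl big1 ?mulr1 ?addr0 //
        => i _; rewrite mulr0.
  move=> e e0; have [t t0 h] := pressure_inf_one m e m0 e0; exists t => //.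
  rewrite (_ : block_entropy _ _ _ = 0) ?add0r //; apply: big1 => j _.
  by case: ifP => _; rewrite ?mul0r // divr1 ln1 mulr0.
have a0 : 0 < a by apply: lt_trans am; rewrite invr_gt0.
have [t t0 ht] := gibbs_parameter m a m0 am a1.
have Z0 : 0 < partition_sum m t.
  by apply: lt_le_trans (partition_sum_ge1 _ _ m0 (ltW t0)).
have hp : block_law m a (fun j => a / partition_sum m t * t ^+ j).
  split=> [j _||].
  - by rewrite mulr_ge0 ?exprn_ge0 ?divr_ge0 ?(ltW a0) ?(ltW t0) ?(ltW Z0).
  - by rewrite -mulr_sumr -/(partition_sum m t) divfK // gt_eqF.
  - have E : a * \sum_(j < m) j.+1%:R * t ^+ j = partition_sum m t.
      apply/eqP; rewrite -subr_eq0 -[X in _ == X]ht mulr_sumr -sumrB; apply/eqP.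
      by apply: eq_bigr => j _; ring.
    rewrite (eq_bigr (fun j : 'I_m => (a * (j.+1%:R * t ^+ j)) / partition_sum m t)).
      by rewrite -mulr_suml -mulr_sumr E divff // gt_eqF.
    by move=> j _; ring.
exists (fun j => a / partition_sum m t * t ^+ j) => // e e0; exists t => //.
by rewrite gibbs_block_entropy // lerDl ltW.
Qed.

End Optimum.

(** * The variables of the optimization problem *)

Section Coordinates.
Context {R : realType}.
Variables (m : nat) (a : R).
Hypothesis m3 : (3 <= m)%N.
Implicit Types (x : (m - 2).-tuple R) (p Y F : nat -> R).

Let m2E : (m - 2)%N = m.-2. Proof. by rewrite subn2. Qed.
Let m0 : (0 < m)%N. Proof. exact: leq_trans m3. Qed.

Lemma sum_last2 F :
  \sum_(j < m) F j = \sum_(0 <= j < m - 2) F j + F (m - 2)%N + F m.-1.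
Proof.
rewrite -(big_mkord xpredT) m2E; case: (m) m3 => [|[|n]] //= _.
by rewrite !big_nat_recr.
Qed.

Lemma sum_by_parts Y K :
  \sum_(j < K) j.+1%:R * (Y j - Y j.+1) = \sum_(j < K) Y j - K%:R * Y K.
Proof.
elim: K => [|K IH]; first by rewrite !big_ord0 mul0r subrr.
by rewrite !big_ord_recr /= IH -(natr1 K); ring.
Qed.

(** The frequency of 0 1^(m-1) determined by the coordinates of x. *)
Definition last_coord x : R :=
  1 - a - \sum_(1 <= i < m.-1) extended_coord a x i.

(** The frequency of the word 0 1^j: x_j for j <= m - 2, with x_0 = a,
    the value forced by the total frequency for j = m - 1, then 0. *)
Definition word_freq x (j : nat) : R :=
  if (j <= m - 2)%N then extended_coord a x j
  else if j == m.-1 then last_coord x else 0.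

(** The frequency of the word 0 1^j 0, that is, of the block 0 1^j. *)
Definition block_freq x (j : nat) : R := word_freq x j - word_freq x j.+1.

Lemma word_freq_lo x j : (j <= m - 2)%N -> word_freq x j = extended_coord a x j.
Proof. by rewrite /word_freq => ->. Qed.

Lemma word_freq_last x : word_freq x m.-1 = last_coord x.
Proof. by rewrite /word_freq eqxx ifF // m2E; case: (m) m3 => [|[|n]] //= _; rewrite ltnn. Qed.

Lemma word_freq_end x : word_freq x m = 0.
Proof.
rewrite /word_freq m2E ifF ?ifF //; case: (m) m3 => [|[|n]] //= _.
- by apply/negbTE; rewrite gtn_eqF.
- by apply/negbTE; rewrite -ltnNge ltnW.
Qed.

Lemma block_freq_lo x j : (j < m - 2)%N ->
  block_freq x j = extended_coord a x j - extended_coord a x j.+1.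
Proof. by move=> h; rewrite /block_freq !word_freq_lo // ltnW. Qed.

Let m2S : (m - 2).+1 = m.-1. Proof. by rewrite m2E; case: (m) m3 => [|[|]]. Qed.

Lemma sum_coords x : \sum_(1 <= i < m.-1) extended_coord a x i =
  \sum_(1 <= i < m - 2) extended_coord a x i + extended_coord a x (m - 2).
Proof. by rewrite -m2S big_nat_recr // m2E; case: (m) m3 => [|[|[|]]]. Qed.

Lemma block_freq_last2 x : block_freq x (m - 2) =
  \sum_(1 <= j < m - 2) extended_coord a x j
    + 2 * extended_coord a x (m - 2) + a - 1.
Proof.
rewrite /block_freq word_freq_lo // m2S word_freq_last /last_coord sum_coords.
by ring.
Qed.

Lemma block_freq_last1 x : block_freq x m.-1 = last_coord x.
Proof. by rewrite /block_freq word_freq_last prednK // word_freq_end subr0. Qed.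

Lemma objective_block_freq x :
  objective a x = a * ln a - \sum_(j < m) block_freq x j * ln (block_freq x j).
Proof.
rewrite (sum_last2 (fun j => block_freq x j * ln (block_freq x j))).
rewrite block_freq_last2 block_freq_last1 /objective -/(last_coord x).
rewrite big_add1 -m2S /=.
rewrite (@eq_big_nat _ _ _ 0 (m - 2) _
   (fun j => block_freq x j * ln (block_freq x j))); last first.
  by move=> j /andP[_ jm]; rewrite block_freq_lo.
by ring.
Qed.

Lemma block_entropyE p : 0 < a -> block_law m a p ->
  block_entropy m a p = a * ln a - \sum_(j < m) p j * ln (p j).
Proof.
move=> a0 [p0 pa _]; rewrite -[X in X * _]pa mulr_suml -sumrB.
apply: eq_bigr => j _; have := p0 j (ltn_ord j).
rewrite le_eqVlt => /predU1P[<-|pj]; first by rewrite !mul0r subrr.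
by rewrite ln_div ?posrE // mulrBr.
Qed.

Lemma feasible_block_law x : feasible m a x -> block_law m a (block_freq x).
Proof.
move=> [h1 h2 h3 h4]; split.
- move=> j jm; have [jm2|] := ltnP j (m - 2).
    by rewrite block_freq_lo // subr_ge0; apply: (h1 j.+1).
  rewrite leq_eqVlt => /predU1P[<-|].
    by rewrite block_freq_last2; move: h4; lra.
  rewrite m2S => jm1; have -> : j = m.-1 by apply/eqP; rewrite eqn_leq jm1 -ltnS prednK // jm.
  by rewrite block_freq_last1 subr_ge0.
- rewrite -(big_mkord xpredT (block_freq x)).
  have := telescope_sumr (word_freq x) (leq0n m).
  rewrite word_freq_end word_freq_lo // sub0r => H.
  rewrite -[RHS]opprK -[X in - X]H -sumrN; apply: eq_bigr => j _.
  by rewrite opprB.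
- rewrite sum_by_parts word_freq_end mulr0 subr0.
  rewrite (sum_last2 (word_freq x)) word_freq_last word_freq_lo // /last_coord sum_coords.
  rewrite (@eq_big_nat _ _ _ 0 (m - 2) _ (extended_coord a x)); last first.
    by move=> j /andP[_ jm]; rewrite word_freq_lo // ltnW.
  rewrite big_ltn; last by rewrite m2E; case: (m) m3 => [|[|[|]]].
  by rewrite (_ : extended_coord a x 0 = a) //; ring.
Qed.

Lemma objective_entropy x : 0 < a -> feasible m a x ->
  objective a x = block_entropy m a (block_freq x).
Proof.
move=> a0 /feasible_block_law h.
by rewrite (block_entropyE _ a0 h) objective_block_freq.
Qed.

(** The frequency of the word 0 1^j when the blocks have frequencies p. *)
Definition tail_sum p j : R := \sum_(j <= i < m) p i.

(** The point of the optimization problem with block frequencies p. *)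
Definition law_point p : (m - 2).-tuple R :=
  mktuple (fun j : 'I_(m - 2) => tail_sum p j.+1).

Lemma law_point_coord p j : block_law m a p -> (j <= m - 2)%N ->
  extended_coord a (law_point p) j = tail_sum p j.
Proof.
move=> [_ pa _]; case: j => [_|j jm].
  by rewrite /extended_coord /= -pa /tail_sum big_mkord.
by rewrite /extended_coord /= (nth_mktuple _ _ (Ordinal jm)).
Qed.

Lemma tail_sum_diff p j : (j < m)%N -> tail_sum p j - tail_sum p j.+1 = p j.
Proof. by move=> jm; rewrite /tail_sum big_ltn // addrK. Qed.

Lemma tail_sum_last p : tail_sum p m.-1 = p m.-1.
Proof.
rewrite -[RHS](tail_sum_diff p m.-1) ?prednK //.
by rewrite [X in _ - X]/tail_sum big_geq ?subr0.
Qed.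

Lemma law_point_last p : block_law m a p -> last_coord (law_point p) = p m.-1.
Proof.
move=> hp; have [_ pa p1] := hp.
have Tm : tail_sum p m = 0 by rewrite /tail_sum big_geq.
have := sum_by_parts (tail_sum p) m; rewrite Tm mulr0 subr0.
rewrite (eq_bigr (fun j : 'I_m => j.+1%:R * p j)); last first.
  by move=> j _; rewrite tail_sum_diff.
rewrite p1 (sum_last2 (tail_sum p)) => H.
rewrite /last_coord sum_coords (law_point_coord _ _ hp) //.
rewrite (@eq_big_nat _ _ _ 1 (m - 2) _ (tail_sum p)); last first.
  by move=> j /andP[_ jm]; rewrite law_point_coord // ltnW.
move: H; rewrite (@big_ltn _ _ _ 0); last by rewrite m2E; case: (m) m3 => [|[|[|]]].
have T0 : tail_sum p 0 = a by rewrite -[RHS]pa -(big_mkord xpredT).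
by rewrite T0 tail_sum_last => H; lra.
Qed.

Lemma block_freq_law_point p j : block_law m a p -> (j < m)%N ->
  block_freq (law_point p) j = p j.
Proof.
move=> hp jm; have [jm2|] := ltnP j (m - 2).
  by rewrite block_freq_lo // !law_point_coord // ?tail_sum_diff // ltnW.
rewrite leq_eqVlt => /predU1P[jE|].
  rewrite /block_freq -jE word_freq_lo // m2S word_freq_last law_point_last //.
  rewrite law_point_coord // -[RHS](tail_sum_diff p (m - 2)) ?jE // -jE m2S.
  by rewrite tail_sum_last.
rewrite m2S => jm1; have -> : j = m.-1 by apply/eqP; rewrite eqn_leq jm1 -ltnS prednK // jm.
by rewrite block_freq_last1 law_point_last.
Qed.

Lemma law_point_feasible p : block_law m a p -> feasible m a (law_point p).
Proof.
move=> hp; have [p0 pa p1] := hp.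
have m2m : (m - 2 < m)%N by rewrite ltn_subrL m0.
have mlast : (m.-1 < m)%N by rewrite prednK.
split.
- move=> [//|j] /andP[_ jm].
  have jm' : (j < m)%N by apply: leq_trans jm (ltnW m2m).
  rewrite /= -subr_ge0 -block_freq_lo // block_freq_law_point //.
  exact: p0.
- by rewrite law_point_coord // /tail_sum big_nat sumr_ge0 // => i /andP[_]; apply: p0.
- have := p0 _ mlast; rewrite -law_point_last // /last_coord.
  by rewrite subr_ge0.
- have := p0 _ m2m; rewrite -(block_freq_law_point _ _ hp m2m) block_freq_last2.
  by lra.
Qed.

Lemma objective_law_point p : 0 < a -> block_law m a p ->
  objective a (law_point p) = block_entropy m a p.
Proof.
move=> a0 hp; rewrite (objective_entropy _ a0 (law_point_feasible _ hp)).
apply: eq_bigr => j _; rewrite block_freq_law_point //.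
Qed.

End Coordinates.

Section Dimension.
Context {R : realType}.
Variables (beta : R) (m : nat).
Hypotheses (b12 : 1 < beta < 2) (m3 : (3 <= m)%N).
Hypothesis hb : word_value beta^-1 (nseq m true) = 1.

Let m0 : (0 < m)%N. Proof. exact: leq_trans m3. Qed.
Let lb : 0 < ln beta. Proof. by case/andP: b12 => b1 _; apply: ln_gt0. Qed.

Lemma hausdorff_dim_set0 : hausdorff_dim (set0 : set R) = 0%E.
Proof.
apply/eqP; rewrite eq_le hausdorff_dim_ge0 andbT.
apply: ereal_inf_lbound; exists 0 => //; split=> //=.
apply/eqP; rewrite eq_le; apply/andP; split; last first.
  apply: le_trans (hausdorff_pre_ge0 0 1 set0) _.
  by apply: ereal_sup_ubound; exists 1 => /=.
apply: ge_ereal_sup => _ [delta delta0 <-]; apply: ereal_inf_lbound.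
exists (fun=> set0); last by apply: eseries0 => i _ _; rewrite /diam_pow eqxx.
split=> // i; apply: ge_ereal_sup => z [[x y] []] //.
Qed.

Lemma freq_set_empty a : a < m%:R^-1 -> freq_set beta a = set0.
Proof.
move=> am; apply/seteqP; split=> // x [x01 /cvgrPdist_lt].
have mR : 0 < m%:R :> R by rewrite ltr0n.
pose e := (m%:R^-1 - a) / 2; have e0 : 0 < e by rewrite /e; lra.
move=> /(_ _ e0) [N _ hN].
(* n is so large that e * n >= 1. *)
pose n := (N + (Num.truncn (e^-1)).+1)%N.
have n0 : 0 < n%:R :> R by rewrite ltr0n /n addnS.
have ne : 1 <= e * n%:R.
  rewrite -ler_pdivrMl // mulr1; apply: ltW.
  by apply: lt_le_trans (truncnS_gt _) _; rewrite ler_nat leq_addl.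
have := hN n (leq_addr _ _); rewrite /= num_zero_digitsE // => hn.
have mm : (m.-1 < m)%N by rewrite prednK.
have x1 : x < word_value beta^-1 (nseq m.-1.+1 true).
  by rewrite prednK // hb; case/andP: x01.
have hr := greedy_word_bounded_runs beta m m.-1 n x b12 hb mm x01 x1.
have := bounded_runs_zeros _ _ _ m0 hr; rewrite size_greedy_word.
set z := count _ _ in hn *; move=> hz.
have {}hz : n%:R <= m%:R * z%:R + m%:R :> R.
  by rewrite -natrM -natrD ler_nat (leq_trans hz) // leq_add2l ltnW.
have h1 : z%:R / n%:R < a + e.
  by move: hn; rewrite ltr_norml => /andP[h _]; move: h; lra.
have {}h1 : z%:R < (a + e) * n%:R by rewrite -ltr_pdivrMr.
have : n%:R <= m%:R * (z%:R + 1) :> R by rewrite mulrDr mulr1.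
rewrite -ler_pdivrMl // => h2; have : a + e = m%:R^-1 - e by rewrite /e; lra.
by move=> aE; move: h1 h2 ne; rewrite aE; lra.
Qed.

Lemma hausdorff_dim_freq_set_eq0 a :
  (forall e, 0 < e -> exists2 t, 0 < t & pressure m a t <= e) ->
  hausdorff_dim (freq_set beta a) = 0%E.
Proof.
move=> h; apply/eqP; rewrite eq_le hausdorff_dim_ge0 andbT.
apply/lee_addgt0Pr => e e0; rewrite add0e.
have [t t0 ht] := h (e * ln beta) (mulr_gt0 e0 lb).
have -> : e = (ln beta)^-1 * (e * ln beta) by field; rewrite gt_eqF.
by apply: (hausdorff_dim_freq_set_le _ m _ t) => //; rewrite mulr_ge0 // ltW.
Qed.

Lemma hausdorff_dim_freq_set_entropy a p : 0 < a -> a <= 1 -> block_law m a p ->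
  (forall e, 0 < e -> exists2 t, 0 < t & pressure m a t <= block_entropy m a p + e) ->
  hausdorff_dim (freq_set beta a) = ((ln beta)^-1 * block_entropy m a p)%:E.
Proof.
move=> a0 a1 hp h; have M0 := block_entropy_ge0 _ _ _ hp.
apply/eqP; rewrite eq_le; apply/andP; split.
  apply/lee_addgt0Pr => e e0.
  have el : 0 < e * ln beta by rewrite mulr_gt0.
  have [t t0 ht] := h _ el.
  have -> : (((ln beta)^-1 * block_entropy m a p)%:E + e%:E)%E
      = ((ln beta)^-1 * (block_entropy m a p + e * ln beta))%:E.
    by rewrite -EFinD; congr EFin; field; rewrite gt_eqF.
  by apply: (hausdorff_dim_freq_set_le _ m _ t) => //; rewrite addr_ge0 // ltW.
apply: le_ereal_inf_tmp => _ [s [s0 hs] <-]; rewrite lee_fin leNgt.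
apply/negP => hlt; case: hp => p0 pa p1.
have hl : s * ln beta < block_entropy m a p by rewrite -ltr_pdivlMr // mulrC.
have := @hausdorff_measure_freq_set_neq0 R beta m a p s b12 m3 hb a0 a1 p0 pa p1 s0 hl.
by rewrite hs eqxx.
Qed.

End Dimension.

Theorem theorem1p3 (R : realType) (beta : R) (m : nat)
    (hbeta : 1 < beta < 2) (hm : (3 <= m)%N)
    (hexp : forall n : nat, (1 <= n)%N ->
       digit beta n 1 = if (n <= m)%N then 1 else 0) :
  [/\ forall a : R, 0 <= a < m%:R^-1 ->
        freq_set beta a = set0 /\ hausdorff_dim (freq_set beta a) = 0%E,
      forall a : R, m%:R^-1 <= a <= 1 ->
        exists M : R,
          is_maximum [set objective a x | x in feasible m a] M /\
          hausdorff_dim (freq_set beta a) = ((ln beta)^-1 * M)%:E,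
      hausdorff_dim (freq_set beta (m%:R^-1)) = 0%E &
      hausdorff_dim (freq_set beta 1) = 0%E].
Proof.
have hb := multinacci_root beta m hbeta hexp.
have m0 : (0 < m)%N by apply: leq_trans hm.
have m1 : (1 < m)%N by apply: leq_trans hm.
split.
- move=> a /andP[_ am]; have E := freq_set_empty _ _ hbeta hm hb _ am.
  by rewrite E hausdorff_dim_set0.
- move=> a ha; have /andP[am a1] := ha.
  have a0 : 0 < a by apply: lt_le_trans am; rewrite invr_gt0 ltr0n.
  have [p hp h] := optimal_block_law m a m1 ha.
  exists (block_entropy m a p); split; last first.
    exact: hausdorff_dim_freq_set_entropy.
  split.
    exists (law_point m p); first exact: law_point_feasible.
    exact: objective_law_point.
  move=> _ [x hx <-]; rewrite objective_entropy //.
  apply/ler_addgt0Pr => e e0; have [t t0 ht] := h e e0; apply: le_trans ht.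
  by apply: block_entropy_le_pressure => //; apply: feasible_block_law.
- by apply: (hausdorff_dim_freq_set_eq0 _ m) => // e; apply: pressure_inf_min.
- by apply: (hausdorff_dim_freq_set_eq0 _ m) => // e; apply: pressure_inf_one.
Qed.
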